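(* Let $L$ be a decomposable exact Lagrangian filling of a Legendrian link $K$ in $\mathbb{R}^3$ (given by a finite sequence of moves from $\emptyset$ to a front diagram of $K$). Then the normal ruling of $K$ associated with $L$ has an even number of clasps.
   Context: **Fronts.** $\mathbb{R}^3$ has the standard contact structure $\ker(dz-y\,dx)$. A Legendrian link is a smooth link everywhere tangent to it. Its front diagram is its projection to the $(x,z)$-plane, which has left cusps, right cusps and transverse crossings and no vertical tangents. Front diagrams are assumed generic: all cusps and crossings have distinct $x$-coordinates. **Normal rulings.** Let $\rho$ be a subset of the crossings of a front diagram $D$. Resolving a crossing means replacing it by two non-crossing horizontal strands, one above the other. Let $D'$ be the result of resolving all crossings in $\rho$. Then $\rho$ is a normal ruling of $D$ if: (1) each component of $D'$ has exactly one left cusp, one right cusp and no self-intersections; (2) at each resolved crossing the two horizontal strands belong to different components of $D'$; (3) (normality) on the vertical line through each resolved crossing, the two vertical intervals bounded by the upper and lower strands of the two components involved are either disjoint or nested (one inside the other). Elements of $\rho$ are called switches, $D'$ is the resolution of $\rho$, and its components are called eyes. The empty diagram has the empty normal ruling. **Clasps.** An eye $E$ has an upper strand $E_u$ and a lower strand $E_l$ over its $x$-range. Two distinct eyes $E,F$ of a resolution are non-nested at $x$ if $E_u>F_u>E_l>F_l$ or $F_u>E_u>F_l>E_l$ at $x$ (so disjoint counts as nested). Let $I$ be a maximal open interval of $x$-values on which $E,F$ are non-nested; at each of its two endpoints $E$ and $F$ cross. Each such crossing is of type T (two upper strands cross), B (two lower strands cross) or M (the lower strand of one eye crosses the upper strand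 of the other). The interval $I$ carries one clasp unless exactly one of its two endpoint crossings is of type M (i.e. unless a single strand of one eye meets both strands of the other eye at the two endpoints), in which case it carries none. The number of clasps of $\rho$ is the total number of clasps over all intervals $I$ and all unordered pairs of distinct eyes of the resolution. **Legendrian isotopy moves.** These are regular isotopy (planar isotopy of fronts, with no vertical tangents, preserving cusps and crossings but possibly changing the order of their $x$-coordinates) and the Legendrian Reidemeister moves, used in either direction: R1 (a strand is replaced by a zigzag with one left cusp, one right cusp and one crossing), R2 (a strand is pushed across a cusp, creating two crossings), R3 (a strand is pushed across a crossing of two other strands). Each move is taken to occur in a thin vertical strip containing no other crossings or cusps. **Ruling correspondence.** For each Legendrian isotopy move $D\to\widetilde D$, normal rulings of $D$ correspond one-to-one to normal rulings of $\widetilde D$ as follows (a theorem of Chekanov–Pushkar'). Crossings outside the strip keep their status (switch or non-switch). - Regular isotopy not interchanging the $x$-order of two crossings: the set of switches is unchanged. Regular isotopy interchanging the $x$-order of two crossings $a,b$: if the strands through $a$ and $b$ belong to exactly two eyes of the resolution and exactly one of $a,b$ is a switch, the new ruling instead has the other one of $a,b$ as a switch; in all other cases the set of switches is unchanged. - R1: the new crossing is a switch. R2: neither of the two new crossings is a switch. - R3: let $p,q,r$ be the three crossings before the move and $p',q',r'$ those after, each listed in increasing $x$-order (so the strands meeting at $p,q,r$ meet at $r',q',p'$ respectively). Then $\emptyset\leftrightarrow\emptyset$, $\{p\}\leftrightarrow\{r'\}$, $\{q\}\leftrightarrow\{q'\}$, $\{r\}\leftrightarrow\{p'\}$, $\{p,q,r\}\leftrightarrow\{p',q',r'\}$,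 $\{p,q\}\leftrightarrow\{p',r'\}$, $\{q,r\}\leftrightarrow\{p',r'\}$, and $\{p,r\}\leftrightarrow\{p',q'\}$ or $\{q',r'\}$, whichever gives a normal ruling (for given switches outside the strip exactly one does; likewise at most one of $\{p,q\},\{q,r\}$ occurs). **Handle moves.** A 0-handle move adds to the front a new small standard unknot front (one left cusp, one right cusp, no crossings) in a region disjoint from the rest of the diagram. A 1-handle move replaces a right cusp facing a left cusp immediately to its right (with nothing in between) by two parallel horizontal strands. Under either handle move the crossings are unchanged, and a ruling is transported by keeping the same set of switches. **Decomposable fillings and associated ruling.** Each Legendrian isotopy move, 0-handle move or 1-handle move taking a front of $K_-$ to a front of $K_+$ gives an embedded exact Lagrangian cobordism from $K_-$ to $K_+$ in the symplectization $(\mathbb{R}_t\times\mathbb{R}^3,\,d(e^t(dz-y\,dx)))$. A decomposable exact Lagrangian filling $L$ of $K$ is one arising by composing the cobordisms of a finite sequence (length $\ge1$) of such moves $\emptyset=D_0\to D_1\to\cdots\to D_N$ with $D_N$ a front diagram of $K$. Orientability is not required. The normal ruling associated with $L$ is $\rho_N$, where $\rho_0=\emptyset$ and $\rho_{i+1}$ is obtained from $\rho_i$ by the ruling correspondence (Legendrian isotopy move) or by keeping the same switches (0-handle or 1-handle move). *)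

(* Defs.v *)
From mathcomp Require Import all_boot.

Set Implicit Arguments.
Unset Strict Implicit.
Unset Printing Implicit Defensive.

(* A generic front diagram is recorded by the list of its cusps and crossings
   in increasing order of their x-coordinates.  This list determines the front
   up to planar isotopies that preserve the x-order, and every list satisfying
   [is_front] below comes from a front.  The strands met by a vertical line
   are numbered 0, 1, 2, ... from the bottom to the top.
   [Event LeftCusp k] : the two strands born at the cusp are numbered k and
     k+1 just to its right;
   [Event RightCusp k] : the strands k and k+1 just to its left end there;
   [Event Crossing k] : the strands k and k+1 cross. *)
Inductive event_kind := LeftCusp | RightCusp | Crossing.

Record event := Event { kind : event_kind; pos : nat }.

Notation "'L_ k" := (Event LeftCusp k) (at level 8, k at level 2).
Notation "'R_ k" := (Event RightCusp k) (at level 8, k at level 2).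
Notation "'X_ k" := (Event Crossing k) (at level 8, k at level 2).

Definition is_lcusp (e : event) : bool :=
  if kind e is LeftCusp then true else false.
Definition is_rcusp (e : event) : bool :=
  if kind e is RightCusp then true else false.
Definition is_crossing (e : event) : bool :=
  if kind e is Crossing then true else false.

(* Numbers of strands ending at the event from the left, and leaving it to the
   right. *)
Definition fan_in (t : event_kind) : nat := if t is LeftCusp then 0 else 2.
Definition fan_out (t : event_kind) : nat := if t is RightCusp then 0 else 2.

Definition diagram := seq event.

Fixpoint is_front_from (w : nat) (D : diagram) : bool :=
  if D is e :: D' then
    (pos e + fan_in (kind e) <= w)
      && is_front_from (w - fan_in (kind e) + fan_out (kind e)) D'
  else w == 0.

Definition is_front (D : diagram) : bool := is_front_from 0 D.

(* Slice i (0 <= i <= size D) is a vertical line between events i-1 and i. *)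
Definition width (D : diagram) (i : nat) : nat :=
  foldl (fun w e => w - fan_in (kind e) + fan_out (kind e)) 0 (take i D).

Definition ev (D : diagram) (i : nat) : event := nth ('X_0) D i.

(* A set of crossings of D is encoded by its characteristic sequence
   [rho : bitseq] along D, which is false at the cusps. *)
Definition is_crossing_set (D : diagram) (rho : bitseq) : bool :=
  all2 (fun e s => s ==> is_crossing e) D rho.

Definition switch (rho : bitseq) (i : nat) : bool := nth false rho i.

(* The number, to the right of the event e, of the strand numbered k to its
   left, in the resolution; the crossing e is resolved when s holds. *)
Definition through (e : event) (s : bool) (k : nat) : option nat :=
  match kind e with
  | LeftCusp => Some (if k < pos e then k else k.+2)
  | RightCusp =>
      if k < pos e then Some k
      else if k < (pos e).+2 then None else Some (k - 2)
  | Crossing =>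
      Some (if s then k
            else if k == pos e then k.+1
            else if k == (pos e).+1 then k.-1 else k)
  end.

(* Strand segments are pairs (slice, number of the strand on the slice); there
   are at most 2 * size D strands on a slice. *)
Definition point (D : diagram) : finType :=
  ('I_(size D).+1 * 'I_(size D).*2.+1)%type.

Definition pt (D : diagram) (i k : nat) : point D := (inord i, inord k).

Definition strands (D : diagram) : {set point D} :=
  [set x : point D | x.2 < width D x.1].

Definition joined (D : diagram) (rho : bitseq) (x y : nat * nat) : bool :=
  let: (i, k) := x in
  let: (j, l) := y in
  [|| [&& i < size D, k < width D i, j == i.+1
        & through (ev D i) (switch rho i) k == Some l],
      [&& 0 < i <= size D, j == i, is_lcusp (ev D i.-1),
          k == pos (ev D i.-1) & l == k.+1]
    | [&& i < size D, j == i, is_rcusp (ev D i),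
          k == pos (ev D i) & l == k.+1] ].

Definition adjacent (D : diagram) (rho : bitseq) : rel (point D) :=
  fun x y =>
    joined D rho (val x.1, val x.2) (val y.1, val y.2)
    || joined D rho (val y.1, val y.2) (val x.1, val x.2).

Section Resolution.

Variables (D : diagram) (rho : bitseq).

Definition component (x : point D) : {set point D} :=
  [set y | connect (adjacent rho) x y].

Definition components : {set {set point D}} :=
  [set component x | x in strands D].

(* The component through the strand k of slice i. *)
Definition component_at (i k : nat) : {set point D} := component (pt D i k).

Definition left_cusps (C : {set point D}) : {set 'I_(size D)} :=
  [set i : 'I_(size D) |
     is_lcusp (ev D i) && (pt D i.+1 (pos (ev D i)) \in C)].

Definition right_cusps (C : {set point D}) : {set 'I_(size D)} :=
  [set i : 'I_(size D) |
     is_rcusp (ev D i) && (pt D i (pos (ev D i)) \in C)].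

Definition self_intersects_at (C : {set point D}) (i : nat) : bool :=
  [&& is_crossing (ev D i), ~~ switch rho i,
      pt D i (pos (ev D i)) \in C & pt D i (pos (ev D i)).+1 \in C].

(* In increasing order.  An eye has exactly two strands on every slice of its
   x-range, namely its lower strand and its upper strand. *)
Definition heights (C : {set point D}) (i : nat) : seq nat :=
  [seq k <- iota 0 (width D i) | pt D i k \in C].

Definition lower (C : {set point D}) (i : nat) : nat := head 0 (heights C i).
Definition upper (C : {set point D}) (i : nat) : nat := last 0 (heights C i).

Definition disjoint_at (E F : {set point D}) (i : nat) : bool :=
  (upper E i < lower F i) || (upper F i < lower E i).

Definition inside_at (E F : {set point D}) (i : nat) : bool :=
  (lower F i < lower E i) && (upper E i < upper F i).

Definition normal_at (i : nat) : bool :=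
  let E := component_at i (pos (ev D i)) in
  let F := component_at i (pos (ev D i)).+1 in
  [|| disjoint_at E F i, inside_at E F i | inside_at F E i].

Definition normal_ruling : bool :=
  [&& is_crossing_set D rho,
      [forall C in components,
         [&& #|left_cusps C| == 1, #|right_cusps C| == 1
           & [forall i : 'I_(size D), ~~ self_intersects_at C i]]],
      [forall i : 'I_(size D), switch rho i ==>
         (component_at i (pos (ev D i)) != component_at i (pos (ev D i)).+1)]
    & [forall i : 'I_(size D), switch rho i ==> normal_at i]].

(* False when E or F has no strand on slice i, since then lower = upper = 0
   for that component. *)
Definition non_nested (E F : {set point D}) (i : nat) : bool :=
  [&& upper E i > upper F i, upper F i > lower E i & lower E i > lower F i]
  || [&& upper F i > upper E i, upper E i > lower F i & lower F i > lower E i].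

(* The open interval bounded by the events l < r is a maximal interval on which
   E and F are non-nested: it meets the slices l+1, ..., r.  (A crossing
   between E and F always interchanges nested and non-nested, so that a maximal
   run of non-nested slices contains no such crossing.) *)
Definition non_nested_interval (E F : {set point D}) (l r : nat) : bool :=
  [&& l < r, ~~ non_nested E F l,
      all (non_nested E F) (iota l.+1 (r - l)) & ~~ non_nested E F r.+1].

(* Given that E and F cross at the event i. *)
Definition type_M (E F : {set point D}) (i : nat) : bool :=
  let k := pos (ev D i) in
  [|| (k == lower E i) && (k.+1 == upper F i),
      (k == upper E i) && (k.+1 == lower F i),
      (k == lower F i) && (k.+1 == upper E i)
    | (k == upper F i) && (k.+1 == lower E i)].

Definition clasps_between (E F : {set point D}) : nat :=
  #|[set I : 'I_(size D) * 'I_(size D) |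
      non_nested_interval E F I.1 I.2
      && ~~ (type_M E F I.1 (+) type_M E F I.2)]|.

(* [clasps_between] is symmetric; the comparison of ranks selects each unordered
   pair of distinct eyes once. *)
Definition clasps : nat :=
  \sum_(E in components)
    \sum_(F in components | enum_rank E < enum_rank F) clasps_between E F.

End Resolution.

(* Two events, consecutive in x and involving disjoint sets of strands, exchange
   their x-order.  On the slice before the two events the lower one is at j and
   the upper one at k; the first one to occur renumbers the strands above it. *)
Inductive exchange : diagram -> diagram -> Type :=
| ExchangeUp (l u : event_kind) (j k : nat) of j + fan_in l <= k :
    exchange [:: Event l j; Event u (k - fan_in l + fan_out l)]
             [:: Event u k; Event l j]
| ExchangeDown (l u : event_kind) (j k : nat) of j + fan_in l <= k :
    exchange [:: Event u k; Event l j]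
             [:: Event l j; Event u (k - fan_in l + fan_out l)].

(* The strand k becomes a zigzag. *)
Inductive reidemeister1 : diagram -> Type :=
| R1Above (k : nat) : reidemeister1 [:: 'L_k.+1; 'X_k; 'R_k.+1]
| R1Below (k : nat) : reidemeister1 [:: 'L_k; 'X_k.+1; 'R_k].

(* Left: a strand passing beyond the tip of the cusp, above or below it.  Right:
   the same strand crossing the two branches of the cusp. *)
Inductive reidemeister2 : diagram -> diagram -> Type :=
| R2LeftAbove (k : nat) : reidemeister2 [:: 'L_k] [:: 'L_k.+1; 'X_k; 'X_k.+1]
| R2LeftBelow (k : nat) : reidemeister2 [:: 'L_k.+1] [:: 'L_k; 'X_k.+1; 'X_k]
| R2RightAbove (k : nat) : reidemeister2 [:: 'R_k] [:: 'X_k.+1; 'X_k; 'R_k.+1]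
| R2RightBelow (k : nat) : reidemeister2 [:: 'R_k.+1] [:: 'X_k; 'X_k.+1; 'R_k].

Inductive reidemeister3 : diagram -> diagram -> Type :=
| R3Up (k : nat) :
    reidemeister3 [:: 'X_k; 'X_k.+1; 'X_k] [:: 'X_k.+1; 'X_k; 'X_k.+1]
| R3Down (k : nat) :
    reidemeister3 [:: 'X_k.+1; 'X_k; 'X_k.+1] [:: 'X_k; 'X_k.+1; 'X_k].

(* A is the part of the front to the left of the strip in which the move occurs
   and B the part to its right.  In [Handle1] the two cusps lie in the same gap
   between strands, so they face each other up to a planar isotopy preserving
   the x-order. *)
Inductive move : diagram -> diagram -> Type :=
| SameOrderIsotopy (D : diagram) : move D D
| Exchange (A B w w' : diagram) of exchange w w' :
    move (A ++ w ++ B) (A ++ w' ++ B)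
| R1 (A B w : diagram) of reidemeister1 w : move (A ++ B) (A ++ w ++ B)
| R1inv (A B w : diagram) of reidemeister1 w : move (A ++ w ++ B) (A ++ B)
| R2 (A B w w' : diagram) of reidemeister2 w w' :
    move (A ++ w ++ B) (A ++ w' ++ B)
| R2inv (A B w w' : diagram) of reidemeister2 w w' :
    move (A ++ w' ++ B) (A ++ w ++ B)
| R3 (A B w w' : diagram) of reidemeister3 w w' :
    move (A ++ w ++ B) (A ++ w' ++ B)
| Handle0 (A B : diagram) (k : nat) :
    move (A ++ B) (A ++ [:: 'L_k; 'R_k] ++ B)
| Handle1 (A B : diagram) (k : nat) :
    move (A ++ [:: 'R_k; 'L_k] ++ B) (A ++ B).

(* The consecutive events i and i+1 of D are crossings, exactly one of them is a
   switch, and their strands belong to exactly two eyes. *)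
Definition interchanges_switches (D : diagram) (rho : bitseq) (i : nat) : bool :=
  [&& is_crossing (ev D i), is_crossing (ev D i.+1),
      switch rho i (+) switch rho i.+1
    & #|[set component_at D rho i (pos (ev D i));
             component_at D rho i (pos (ev D i)).+1;
             component_at D rho i.+1 (pos (ev D i.+1));
             component_at D rho i.+1 (pos (ev D i.+1)).+1]| == 2].

(* The characteristic sequences of the switches among the three crossings before
   and after the move. *)
Inductive r3_switches : bitseq -> bitseq -> Prop :=
| R3_none : r3_switches [:: false; false; false] [:: false; false; false]
| R3_p : r3_switches [:: true; false; false] [:: false; false; true]
| R3_q : r3_switches [:: false; true; false] [:: false; true; false]
| R3_r : r3_switches [:: false; false; true] [:: true; false; false]
| R3_pqr : r3_switches [:: true; true; true] [:: true; true; true]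
| R3_pq : r3_switches [:: true; true; false] [:: true; false; true]
| R3_qr : r3_switches [:: false; true; true] [:: true; false; true]
| R3_pr_pq : r3_switches [:: true; false; true] [:: true; true; false]
| R3_pr_qr : r3_switches [:: true; false; true] [:: false; true; true].

Inductive corresponds :
  forall D D' : diagram, move D D' -> bitseq -> bitseq -> Prop :=
| CorrSameOrder D rho : corresponds (SameOrderIsotopy D) rho rho
| CorrExchange A B w w' (m : exchange w w') (a b : bitseq) (s t : bool) :
    size a = size A ->
    ~~ interchanges_switches (A ++ w ++ B) (a ++ [:: s; t] ++ b) (size A) ->
    corresponds (Exchange A B m) (a ++ [:: s; t] ++ b) (a ++ [:: t; s] ++ b)
  (* After the exchange, the event that was second comes first. *)
| CorrExchangeSwitch A B w w' (m : exchange w w') (a b : bitseq) (s t : bool) :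
    size a = size A ->
    interchanges_switches (A ++ w ++ B) (a ++ [:: s; t] ++ b) (size A) ->
    corresponds (Exchange A B m)
      (a ++ [:: s; t] ++ b) (a ++ [:: ~~ t; ~~ s] ++ b)
| CorrR1 A B w (m : reidemeister1 w) (a b : bitseq) :
    size a = size A ->
    corresponds (R1 A B m) (a ++ b) (a ++ [:: false; true; false] ++ b)
| CorrR1inv A B w (m : reidemeister1 w) (a b : bitseq) :
    size a = size A ->
    corresponds (R1inv A B m) (a ++ [:: false; true; false] ++ b) (a ++ b)
| CorrR2 A B w w' (m : reidemeister2 w w') (a b : bitseq) :
    size a = size A ->
    corresponds (R2 A B m)
      (a ++ [:: false] ++ b) (a ++ [:: false; false; false] ++ b)
| CorrR2inv A B w w' (m : reidemeister2 w w') (a b : bitseq) :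
    size a = size A ->
    corresponds (R2inv A B m)
      (a ++ [:: false; false; false] ++ b) (a ++ [:: false] ++ b)
| CorrR3 A B w w' (m : reidemeister3 w w') (a b t t' : bitseq) :
    size a = size A ->
    r3_switches t t' ->
    (t = [:: true; false; true] -> normal_ruling (A ++ w' ++ B) (a ++ t' ++ b)) ->
    corresponds (R3 A B m) (a ++ t ++ b) (a ++ t' ++ b)
| CorrHandle0 A B k (a b : bitseq) :
    size a = size A ->
    corresponds (Handle0 A B k) (a ++ b) (a ++ [:: false; false] ++ b)
| CorrHandle1 A B k (a b : bitseq) :
    size a = size A ->
    corresponds (Handle1 A B k) (a ++ [:: false; false] ++ b) (a ++ b).

(* The decomposable fillings of the link with front D. *)
Inductive filling : diagram -> Type :=
| FillingOne (D : diagram) of move [::] D & is_front D : filling D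
| FillingStep (D D' : diagram) of filling D & move D D' & is_front D' :
    filling D'.

Inductive associated_ruling :
  forall D : diagram, filling D -> bitseq -> Prop :=
| AssociatedOne D (m : move [::] D) (hD : is_front D) (rho : bitseq) :
    corresponds m [::] rho -> associated_ruling (FillingOne m hD) rho
| AssociatedStep D D' (L : filling D) (m : move D D') (hD' : is_front D')
    (rho rho' : bitseq) :
    associated_ruling L rho -> corresponds m rho rho' ->
    associated_ruling (FillingStep L m hD') rho'.

(* Main.v *)
Require Import Defs.
From mathcomp Require Import all_boot.
From mathcomp Require Import zify.

(** Give the upper strand of each eye the sign 1 and the lower one the sign -1,
    and let a crossing that is not a switch have as its weight the product of the
    signs of its two strands: -1 for a crossing of type M, 1 for type T or B.

    Two eyes become interlaced, or cease to be so, precisely where they cross, so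
    that each of their crossings is an end of exactly one maximal non-nested
    interval.  An interval carries a clasp if its two ends have equal weights, and
    then these add up to 2 modulo 4; otherwise they add up to 0.  Every crossing
    that is not a switch is between two eyes.  Hence twice the number of clasps is
    congruent modulo 4 to the total weight of the ruling ([clasps_weight]), and it
    suffices that the total weight is 0 modulo 4.

    The total weight, unlike the number of clasps, is a sum of local terms, and it
    can be followed through the moves.  In the second Reidemeister move a strand
    crosses both strands of an eye, with opposite weights.  In the third one the
    same pairs of strands cross before and after, except that for a switch in the
    middle one pair crossing twice may be replaced by another pair crossing twice,
    which changes the weight by 0 or by 4.  When a crossing and a switch of the
    same two eyes are exchanged, normality makes the crossing one of two upper or
    two lower strands before and after.  The other moves leave the weights as they
    are.  One also has to see that the ruling remains valid, because the argument
    for the next move depends on it.  In the third Reidemeister move this rests on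
    normality being transitive along three consecutive strands ([nested_trans]).

    To compute with rulings, a slice is described by the list of the labels of the
    eyes of its strands, each eye being named by its left cusp.  Two points of the
    resolution are in the same component if and only if they have the same label
    ([component_atE]). *)

Set Implicit Arguments.
Unset Strict Implicit.
Unset Printing Implicit Defensive.

(** * Eye labels on the slices of a front *)

(** Effect of an event on the list of eye labels of a slice, read from the
    bottom strand to the top one; the eye born at a left cusp gets the label
    [new].  A switch leaves the list unchanged because the resolved strands keep
    their heights. *)
Definition step (e : event) (sw : bool) (new : nat) (s : seq nat) : seq nat :=
  let k := pos e in
  match kind e with
  | LeftCusp => take k s ++ [:: new, new & drop k s]
  | RightCusp => take k s ++ drop k.+2 s
  | Crossing =>
      if sw then s else take k s ++ [:: nth 0 s k.+1, nth 0 s k & drop k.+2 s]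
  end.

(** Normality at a switch between the adjacent labels [a] and [b] of the slice
    [u ++ [:: a, b & v]].  If [a] occurs in [u] then [a] is the upper strand of
    its eye, otherwise the lower one, and similarly for [b]; comparing the
    [index] of the two other strands, in [u] or in [v], decides which eye is
    inside the other. *)
Definition nested_at (u : seq nat) (a b : nat) (v : seq nat) : bool :=
  if a \in u then (b \in u) ==> (index b u < index a u)
  else (b \notin u) && (index b v < index a v).

(** Conditions imposed on one event by a ruling.  Normality is only imposed when
    [n] holds: for [n := false] what remains is enough to identify eyes with
    labels, so that normality can then be transferred between labels and
    components. *)
Definition event_ok (n : bool) (e : event) (sw : bool) (s : seq nat) : bool :=
  let k := pos e in
  let a := nth 0 s k in
  let b := nth 0 s k.+1 in
  (k + fan_in (kind e) <= size s) &&
  match kind e with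
  | LeftCusp => ~~ sw
  | RightCusp => ~~ sw && (a == b)
  | Crossing =>
      (a != b) && (n && sw ==> nested_at (take k s) a b (drop k.+2 s))
  end.

(** The residue modulo 4 of the product of the signs (upper strand: 1, lower
    strand: -1) of the two strands that cross, so that 3 stands for a crossing
    of type M and 1 for a crossing of type T or B. *)
Definition crossing_weight (u : seq nat) (a b : nat) : nat :=
  if (a \in u) == (b \in u) then 1 else 3.

Definition event_weight (e : event) (sw : bool) (s : seq nat) : nat :=
  let k := pos e in
  if is_crossing e && ~~ sw
  then crossing_weight (take k s) (nth 0 s k) (nth 0 s k.+1) else 0.

Arguments step : simpl never.
Arguments event_ok : simpl never.
Arguments event_weight : simpl never.

Fixpoint run (D : diagram) (rho : bitseq) (new : nat) (s : seq nat) : seq nat :=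
  if D is e :: D' then if rho is sw :: rho' then
    run D' rho' new.+1 (step e sw new s)
  else s else s.

Fixpoint run_ok (n : bool) (D : diagram) (rho : bitseq) (new : nat)
    (s : seq nat) : bool :=
  match D, rho with
  | [::], [::] => true
  | e :: D', sw :: rho' =>
      event_ok n e sw s && run_ok n D' rho' new.+1 (step e sw new s)
  | _, _ => false
  end.

Fixpoint weight (D : diagram) (rho : bitseq) (new : nat) (s : seq nat) : nat :=
  if D is e :: D' then if rho is sw :: rho' then
    event_weight e sw s + weight D' rho' new.+1 (step e sw new s)
  else 0 else 0.

Lemma run_cat A B a b new s : size a = size A ->
  run (A ++ B) (a ++ b) new s = run B b (new + size A) (run A a new s).
Proof.
elim: A a new s => [|e A IH] [|x a] //= new s; first by rewrite addn0.
by move=> [/IH ->]; rewrite addSnnS.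
Qed.

Lemma run_ok_cat n A B a b new s : size a = size A ->
  run_ok n (A ++ B) (a ++ b) new s
  = run_ok n A a new s && run_ok n B b (new + size A) (run A a new s).
Proof.
elim: A a new s => [|e A IH] [|x a] //= new s; first by rewrite addn0.
by move=> [/IH ->]; rewrite addSnnS andbA.
Qed.

Lemma weight_cat A B a b new s : size a = size A ->
  weight (A ++ B) (a ++ b) new s
  = weight A a new s + weight B b (new + size A) (run A a new s).
Proof.
elim: A a new s => [|e A IH] [|x a] //= new s; first by rewrite addn0.
by move=> [/IH ->]; rewrite addSnnS addnA.
Qed.

Lemma run_ok_size n D rho new s : run_ok n D rho new s -> size rho = size D.
Proof.
by elim: D rho new s => [|e D IH] [|x rho] //= new s /andP[_ /IH ->].
Qed.

Lemma event_ok_weaken n e sw s : event_ok n e sw s -> event_ok false e sw s.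
Proof.
by rewrite /event_ok; case: (kind e) => //= /andP[-> /andP[->]].
Qed.

Lemma run_ok_weaken n D rho new s :
  run_ok n D rho new s -> run_ok false D rho new s.
Proof.
elim: D rho new s => [|e D IH] [|x rho] //= new s /andP[/event_ok_weaken ->].
exact: IH.
Qed.

Lemma nth_take_drop_pair (u v : seq nat) (a b : nat) :
  (nth 0 (u ++ [:: a, b & v]) (size u) = a) *
  (nth 0 (u ++ [:: a, b & v]) (size u).+1 = b) *
  (take (size u) (u ++ [:: a, b & v]) = u) *
  (drop (size u).+2 (u ++ [:: a, b & v]) = v).
Proof.
rewrite !nth_cat ltnn subnn ltnNge leqnSn subSnn take_size_cat //=.
by rewrite -addn2 addnC -drop_drop drop_size_cat //= drop0.
Qed.

(** Computation rules for an event at a known position of an explicit slice. *)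
Lemma eventE (u : seq nat) (k : nat) (size_u : size u = k) :
  (forall n sw v, event_ok n ('L_k) sw (u ++ v) = ~~ sw) *
  (forall n sw a b v,
     event_ok n ('R_k) sw (u ++ [:: a, b & v]) = ~~ sw && (a == b)) *
  (forall n sw a b v, event_ok n ('X_k) sw (u ++ [:: a, b & v])
     = (a != b) && (n && sw ==> nested_at u a b v)) *
  (forall sw new v, step ('L_k) sw new (u ++ v) = u ++ [:: new, new & v]) *
  (forall sw new a b v, step ('R_k) sw new (u ++ [:: a, b & v]) = u ++ v) *
  (forall sw new a b v, step ('X_k) sw new (u ++ [:: a, b & v])
     = u ++ (if sw then [:: a, b & v] else [:: b, a & v])) *
  (forall sw a b v, event_weight ('X_k) sw (u ++ [:: a, b & v])
     = if sw then 0 else crossing_weight u a b) *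
  (forall j sw s, event_weight ('L_j) sw s = 0) *
  (forall j sw s, event_weight ('R_j) sw s = 0).
Proof.
have pairE := nth_take_drop_pair u; rewrite -size_u.
split=> //; split=> //.
split; [|by move=> [] a b v; rewrite /event_weight /= ?pairE].
split; [|by move=> [] new a b v; rewrite /step /= ?pairE].
split; [|by move=> sw new a b v; rewrite /step /= !pairE].
split; [|by move=> *; rewrite /step /= take_size_cat // drop_size_cat].
split; [split=> n sw|].
- by move=> v; rewrite /event_ok /= size_cat addn0 leq_addr.
- by move=> a b v; rewrite /event_ok /= !pairE size_cat /= leq_add2l.
by move=> n sw a b v; rewrite /event_ok /= !pairE size_cat /= leq_add2l.
Qed.

(** The same rules one strand higher.  Keeping the strand [c] out of the prefix
    lets events at [k] and at [k.+1] be computed on the same expression. *)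
Lemma eventE1 (u : seq nat) (c k : nat) (size_u : size u = k) :
  (forall n sw v, event_ok n ('L_k.+1) sw (u ++ c :: v) = ~~ sw) *
  (forall n sw a b v,
     event_ok n ('R_k.+1) sw (u ++ [:: c, a, b & v]) = ~~ sw && (a == b)) *
  (forall n sw a b v, event_ok n ('X_k.+1) sw (u ++ [:: c, a, b & v])
     = (a != b) && (n && sw ==> nested_at (rcons u c) a b v)) *
  (forall sw new v,
     step ('L_k.+1) sw new (u ++ c :: v) = u ++ [:: c, new, new & v]) *
  (forall sw new a b v,
     step ('R_k.+1) sw new (u ++ [:: c, a, b & v]) = u ++ c :: v) *
  (forall sw new a b v, step ('X_k.+1) sw new (u ++ [:: c, a, b & v])
     = u ++ c :: (if sw then [:: a, b & v] else [:: b, a & v])) *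
  (forall sw a b v, event_weight ('X_k.+1) sw (u ++ [:: c, a, b & v])
     = if sw then 0 else crossing_weight (rcons u c) a b).
Proof.
have size_uc : size (rcons u c) = k.+1 by rewrite size_rcons size_u.
do !split=> *; by rewrite -cat_rcons (eventE size_uc) ?cat_rcons.
Qed.

Lemma event_ok_pos n e sw s :
  event_ok n e sw s -> pos e + fan_in (kind e) <= size s.
Proof. by case/andP. Qed.

Lemma size_step n e sw new s : event_ok n e sw s ->
  size (step e sw new s) = size s - fan_in (kind e) + fan_out (kind e).
Proof.
move=> /event_ok_pos; rewrite /step.
by case: (kind e) => /= h; rewrite ?size_cat /= ?size_take ?size_drop;
  try case: sw; rewrite ?size_cat /= ?size_take ?size_drop; try lia;
  case: ltnP; lia.
Qed.

Lemma is_front_from_run n A B a new s : run_ok n A a new s ->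
  is_front_from (size s) (A ++ B) = is_front_from (size (run A a new s)) B.
Proof.
elim: A a new s => [|e A IH] [|x a] //= new s /andP[h /IH <-].
by rewrite (size_step _ h) (event_ok_pos h).
Qed.

Lemma split_at2 (s : seq nat) k : k.+2 <= size s ->
  exists u a b v, s = u ++ [:: a, b & v] /\ size u = k.
Proof.
move=> h; exists (take k s), (nth 0 s k), (nth 0 s k.+1), (drop k.+2 s).
rewrite size_takel; last lia; split=> //.
by rewrite -!drop_nth ?cat_take_drop //; lia.
Qed.

Lemma split_at (s : seq nat) k : k <= size s ->
  exists u v, s = u ++ v /\ size u = k.
Proof.
by move=> h; exists (take k s), (drop k s); rewrite cat_take_drop size_takel.
Qed.

(** The property of the slices that makes a label stand for an eye, and that
    leaves the labels from [new] on to the next left cusps. *)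
Definition paired (new : nat) (s : seq nat) : Prop :=
  forall x, x \in s -> x < new /\ count_mem x s = 2.

Lemma paired_perm new s t : perm_eq s t -> paired new s -> paired new t.
Proof.
move=> /permP st hs x xt.
have xs : x \in s by rewrite -has_pred1 has_count st -has_count has_pred1.
by have [xn] := hs x xs; rewrite st.
Qed.

Lemma pairedS new s : paired new s -> paired new.+1 s.
Proof. by move=> h x /h[]; split=> //; lia. Qed.

Lemma pairedL new u v : paired new (u ++ v) ->
  paired new.+1 (u ++ [:: new, new & v]).
Proof.
move=> h; have p : perm_eq [:: new, new & u ++ v] (u ++ [:: new, new & v]).
  by rewrite perm_sym (perm_catCA u [:: new; new] v).
apply: paired_perm p _ => x; rewrite /= !in_cons.
case: (eqVneq x new) => [->|ne] /=.
  move=> _; split=> //.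
  case hn : (new \in u ++ v); first by have [] := h _ hn; rewrite ltnn.
  by rewrite (count_memPn _) // hn.
by move=> /h [lt ->]; split=> //; lia.
Qed.

(** As a label occurs twice on a slice, two adjacent strands of the same eye are
    all of it. *)
Lemma pairedR new u a v : paired new (u ++ [:: a, a & v]) ->
  (a \notin u ++ v) * paired new (u ++ v).
Proof.
move=> h; have [_] := h a ltac:(by rewrite mem_cat inE eqxx orbT).
rewrite count_cat /= eqxx => ca.
have na : a \notin u ++ v.
  rewrite -has_pred1 has_count count_cat -leqNgt leqn0.
  by move: ca; rewrite !addnA addn1 !addnS addn0 => -[->].
split=> // x xs; have [|lt] := h x.
  by move: xs; rewrite !mem_cat !in_cons; case/orP=> ->; rewrite ?orbT.
rewrite !count_cat /=; case: (eqVneq a x) => [ax|_]; last by rewrite !add0n.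
by rewrite ax xs in na.
Qed.

Lemma paired_step n e sw new s : event_ok n e sw s -> paired new s ->
  paired new.+1 (step e sw new s).
Proof.
case: e => [[] k] h; have := event_ok_pos h; rewrite /= ?addn0 ?addn2.
- by case/split_at=> u [v [-> hu]] hs; rewrite (eventE hu); apply: pairedL.
- case/split_at2=> u [a [b [v [es hu]]]].
  move: h; rewrite es !(eventE hu) => /andP[_ /eqP <-].
  by case/pairedR=> _ /pairedS.
case/split_at2=> u [a [b [v [-> hu]]]] hs; rewrite (eventE hu); apply: pairedS.
case: sw h => // _; apply: paired_perm hs.
by rewrite perm_cat2l (perm_catCA [:: a] [:: b] v).
Qed.

Lemma paired_run n D rho new s : run_ok n D rho new s -> paired new s ->
  paired (new + size D) (run D rho new s).
Proof.
elim: D rho new s => [|e D IH] [|x rho] //= new s; first by rewrite addn0.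
move=> /andP[h1 h2] /(paired_step h1) /(IH _ _ _ h2).
by rewrite addSnnS.
Qed.

(** * Relabelling the eyes *)

(** The moves change the labels, since they add or remove left cusps, merge eyes,
    or interchange two eyes; they preserve which strands belong together. *)
Definition similar (s t : seq nat) : Prop :=
  exists2 g : nat -> nat, {in s &, injective g} & t = map g s.

Lemma similar_refl s : similar s s.
Proof. by exists id; rewrite ?map_id. Qed.

Section Relabel.
Variables (g : nat -> nat) (s : seq nat).
Hypothesis gi : {in s &, injective g}.

Lemma index_relabel u x : {subset u <= s} -> x \in s ->
  index (g x) (map g u) = index x u.
Proof.
move=> us xs; elim: u us => //= y u IH us.
have ys : y \in s by apply: us; rewrite mem_head.
rewrite (inj_in_eq gi) // IH // => z zu; apply: us; exact: mem_behead.
Qed.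

Lemma mem_relabel u x : {subset u <= s} -> x \in s ->
  (g x \in map g u) = (x \in u).
Proof.
by move=> us xs; rewrite -!index_mem size_map index_relabel.
Qed.

Lemma nested_at_relabel u a b v : {subset u <= s} -> {subset v <= s} ->
  a \in s -> b \in s ->
  nested_at (map g u) (g a) (g b) (map g v) = nested_at u a b v.
Proof.
by move=> us vs ha hb; rewrite /nested_at !mem_relabel // !index_relabel.
Qed.

Lemma crossing_weight_relabel u a b : {subset u <= s} ->
  a \in s -> b \in s ->
  crossing_weight (map g u) (g a) (g b) = crossing_weight u a b.
Proof. by move=> us ha hb; rewrite /crossing_weight !mem_relabel. Qed.

End Relabel.

Lemma similar_sym s t : similar s t -> similar t s.
Proof.
case=> g gi ->; pose h y := nth 0 s (index y (map g s)).
have hK : {in s, cancel g h}.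
  by move=> x xs; rewrite /h (index_relabel gi) // nth_index.
exists h; last by rewrite -map_comp map_id_in.
by move=> _ _ /mapP[x xs ->] /mapP[y ys ->]; rewrite !hK // => ->.
Qed.

Lemma event_similar n e sw s t new new' :
  paired new s -> paired new' t -> similar s t -> event_ok n e sw s ->
  [/\ event_ok n e sw t, event_weight e sw t = event_weight e sw s
    & similar (step e sw new s) (step e sw new' t)].
Proof.
case: e => [[] k] ps pt [g gi et] h; have := event_ok_pos h;
  rewrite /= ?addn0 ?addn2.
- case/split_at=> u [v [es hu]]; move: h ps pt gi.
  have hgu : size (map g u) = k by rewrite size_map.
  rewrite et {s t et}es map_cat !(eventE hu, eventE hgu).
  move=> h ps pt gi; split=> //.
  have nn : new \notin u ++ v by apply/negP=> /ps[]; rewrite ltnn.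
  have nn' : new' \notin map g (u ++ v).
    by rewrite map_cat; apply/negP=> /pt[]; rewrite ltnn.
  pose g' x := if x == new then new' else g x.
  have g'E : {in u ++ v, g' =1 g}.
    by move=> x xs; rewrite /g'; case: eqVneq xs nn => // -> ->.
  exists g'; last first.
    rewrite map_cat /= {2 3}/g' eqxx; congr (_ ++ [:: _, _ & _]);
    by apply/esym/eq_in_map=> x xs; apply: g'E; rewrite mem_cat xs ?orbT.
  have aux x y : x \in u ++ v -> y \in u ++ v -> g' x = g' y -> x = y.
    by move=> xs ys; rewrite !g'E //; apply: gi.
  have spl x : x \in u ++ [:: new, new & v] -> x = new \/ x \in u ++ v.
    by rewrite !mem_cat !in_cons => /or4P[->|/eqP|/eqP|->]; rewrite ?orbT; auto.
  have bad x : x \in u ++ v -> g' x <> g' new.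
    move=> xs; rewrite g'E // {1}/g' eqxx => E.
    by rewrite -E map_f in nn'.
  move=> x y /spl[->|hx] /spl[->|hy] //; last exact: aux.
    by move/esym/(bad _ hy).
  by move/(bad _ hx).
- case/split_at2=> u [a [b [v [es hu]]]]; move: h ps pt gi.
  have hgu : size (map g u) = k by rewrite size_map.
  rewrite et {s t et}es map_cat /= !(eventE hu, eventE hgu).
  move=> /andP[-> /eqP <-] ps pt gi; rewrite eqxx; split=> //.
  exists g; last by rewrite map_cat.
  apply: sub_in2 gi => x; rewrite !mem_cat !in_cons.
  by case/orP=> ->; rewrite ?orbT.
case/split_at2=> u [a [b [v [es hu]]]]; move: h ps pt gi.
have hgu : size (map g u) = k by rewrite size_map.
rewrite et {s t et}es map_cat /= !(eventE hu, eventE hgu) => /andP[ab no] ps pt gi.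
have us : {subset u <= u ++ [:: a, b & v]}.
  by move=> x xu; rewrite mem_cat xu.
have vs : {subset v <= u ++ [:: a, b & v]}.
  by move=> x xu; rewrite mem_cat !in_cons xu !orbT.
have ha : a \in u ++ [:: a, b & v] by rewrite mem_cat !in_cons eqxx orbT.
have hb : b \in u ++ [:: a, b & v] by rewrite mem_cat !in_cons eqxx !orbT.
rewrite (nested_at_relabel gi) // (crossing_weight_relabel gi) //.
rewrite (inj_in_eq gi) // ab; split=> //.
exists g; last by rewrite map_cat; case: (sw).
case: sw {no} => //; apply: sub_in2 gi => x; rewrite !mem_cat !in_cons.
by case/or4P=> ->; rewrite ?orbT.
Qed.

(** Validity and weight only depend on which strands belong to the same eye. *)
Lemma run_similar n D rho s t new new' :
  paired new s -> paired new' t -> similar s t -> run_ok n D rho new s ->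
  run_ok n D rho new' t /\ weight D rho new' t = weight D rho new s.
Proof.
elim: D rho s t new new' => [|e D IH] [|x rho] //= s t new new' ps pt st.
case/andP=> h1 h2; have [h1' -> st'] := event_similar ps pt st h1.
have [] := IH rho _ _ _ _ (paired_step h1 ps) (paired_step h1' pt) st' h2.
by rewrite h1' => -> ->.
Qed.

(** * Moves inside a strip *)

(** The invariant of the moves.  By [clasps_weight] the weight is twice the
    number of clasps modulo 4. *)
Definition balanced (D : diagram) (rho : bitseq) : Prop :=
  run_ok true D rho 0 [::] /\ weight D rho 0 [::] = 0 %[mod 4].

(** [is_front_from] for a strip, from which strands may go on to the right. *)
Fixpoint fits (m : nat) (D : diagram) : bool :=
  if D is e :: D' then
    (pos e + fan_in (kind e) <= m)
      && fits (m - fan_in (kind e) + fan_out (kind e)) D'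
  else true.

Lemma fits_front m D B : is_front_from m (D ++ B) -> fits m D.
Proof. by elim: D m => //= e D IH m /andP[-> /IH ->]. Qed.

Lemma fits_run n D rho new s : run_ok n D rho new s -> fits (size s) D.
Proof.
elim: D rho new s => //= e D IH [|x rho] // new s /andP[h /IH].
by rewrite (size_step _ h) (event_ok_pos h).
Qed.

(** Two strips with their switches can be exchanged without any effect on the
    rest of the front. *)
Definition strip_equiv (new : nat) (s : seq nat) w t w' t' : Prop :=
  [/\ run_ok true w' t' new s,
      similar (run w t new s) (run w' t' new s)
    & weight w' t' new s = weight w t new s %[mod 4]].

(** A move is local: the slice to the left of the strip is the same before and
    after, and the slices to the right agree up to the names of the eyes. *)
Lemma local_move A w w' B a t t' b (s := run A a 0 [::]) :
    size a = size A -> size t = size w -> size t' = size w' ->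
    balanced (A ++ w ++ B) (a ++ t ++ b) -> is_front (A ++ w' ++ B) ->
    (run_ok true A a 0 [::] -> paired (size A) s ->
     run_ok true w t (size A) s -> fits (size s) w' ->
     strip_equiv (size A) s w t w' t') ->
  balanced (A ++ w' ++ B) (a ++ t' ++ b).
Proof.
move=> sa st st' [ok wt] fr.
move: ok wt; rewrite /balanced !run_ok_cat // !weight_cat //.
move=> /and3P[okA okw okB] wt.
have pA : paired (size A) s by exact: (paired_run okA).
rewrite add0n -/s in okw okB wt * => /(_ okA pA okw).
rewrite /is_front (is_front_from_run _ okA : is_front_from 0 _ = _) in fr.
case=> [|okw' sim]; first exact: fits_front fr.
move=> wtw; rewrite okA okw' /=.
have [-> ->] := run_similar (paired_run okw pA) (paired_run okw' pA) sim okB.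
split=> //; rewrite -wt; lia.
Qed.

Lemma nested_rcons u c a b v : a != c -> b != c ->
  nested_at (rcons u c) a b v = nested_at u a b v.
Proof.
move=> ac bc; rewrite /nested_at !mem_rcons !in_cons (negbTE ac) (negbTE bc) /=.
by case: ifP => // ha; case hb: (b \in u) => //; rewrite -cats1 !index_cat ha hb.
Qed.

Lemma nested_cons u c a b v : a != c -> b != c ->
  nested_at u a b (c :: v) = nested_at u a b v.
Proof.
by move=> ac bc; rewrite /nested_at /= ![c == _]eq_sym (negbTE ac) (negbTE bc).
Qed.

Lemma crossing_weight_rcons u c a b : a != c -> b != c ->
  crossing_weight (rcons u c) a b = crossing_weight u a b.
Proof.
by move=> ac bc; rewrite /crossing_weight !mem_rcons !in_cons (negbTE ac) (negbTE bc).
Qed.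

Lemma crossing_weightC u a b : crossing_weight u a b = crossing_weight u b a.
Proof. by rewrite /crossing_weight eq_sym. Qed.

(** In the third Reidemeister move a strand may stop crossing a second strand
    twice and cross a third one twice instead.  The types of these crossings are
    unrelated, and only modulo 4 do they weigh the same: [1 + 1 = 3 + 3]. *)
Lemma crossing_weight_double u a b :
  crossing_weight u a b + crossing_weight u a b = 2 %[mod 4].
Proof. by rewrite /crossing_weight; case: ifP. Qed.

(** Normality compares how far two eyes extend past the adjacent strands, and so
    it is transitive along three consecutive strands. *)
Lemma nested_trans u v a b c :
  nested_at u a b v -> nested_at u b c v -> nested_at u a c v.
Proof.
rewrite /nested_at; case: (a \in u) (b \in u) (c \in u) => [] [] [] //=; lia.
Qed.

(** The two strands of one eye enclose a single strand of the other eye, so that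
    the eyes are neither nested nor disjoint. *)
Lemma nested_cons_neq u a b v : a \notin u -> nested_at u a b (a :: v) = false.
Proof. by move=> /negbTE; rewrite /nested_at /= eqxx ltn0 andbF => ->. Qed.

Lemma nested_rcons_neq u a b v : a != b -> b \notin u ->
  nested_at (rcons u b) a b v = false.
Proof.
move=> ab bu; rewrite /nested_at !mem_rcons !in_cons (negbTE ab) eqxx /=.
case: ifP => //= au; rewrite -cats1 !index_cat au (negbTE bu) /= eqxx addn0.
by apply/negbTE; rewrite -leqNgt ltnW // index_mem.
Qed.

Lemma paired_new new s : paired new s -> new \notin s.
Proof. by move=> h; apply/negP=> /h[]; rewrite ltnn. Qed.

(** The new crossing is a switch that cuts off a small eye.  This eye lies next
    to the strand and has no other crossing, so that nothing else changes. *)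
Lemma strip_R1 w new s (t := [:: false; true; false]) :
  reidemeister1 w -> paired new s -> fits (size s) w ->
  [/\ run_ok true w t new s, run w t new s = s & weight w t new s = 0].
Proof.
rewrite {}/t; case=> k ps /= fit.
- have hk : k < size s by case/andP: fit; lia.
  have [|u [v [es hu]]] := @split_at s k; first lia.
  case: v es => [|c v] es; first by move: hk; rewrite es size_cat /=; lia.
  rewrite es in ps *; have := paired_new ps; rewrite mem_cat in_cons !negb_or.
  case/and3P=> nu nc nv.
  rewrite !(eventE hu, eventE1 _ hu) /= eqxx (negbTE (_ : c != new)) 1?eq_sym //=.
  rewrite /nested_at (negbTE nu) /= eqxx (negbTE nc).
  by case: ifP.
have hk : k < size s by case/and3P: fit; lia.
have [|u [v [es hu]]] := @split_at s k; first lia.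
case: v es => [|c v] es.
  by move: hk; rewrite es size_cat /=; lia.
rewrite es in ps *; have := paired_new ps; rewrite mem_cat in_cons !negb_or.
case/and3P=> nu nc nv.
rewrite !(eventE hu, eventE1 _ hu) /= eqxx nc /nested_at !mem_rcons mem_head.
rewrite in_cons [c == _]eq_sym (negbTE nc) /=; split=> //.
rewrite andbT; apply/implyP=> cu; rewrite -cats1 !index_cat cu (negbTE nu) /=.
by rewrite eqxx addn0 index_mem.
Qed.

(** A strand that crosses the two branches of a cusp crosses an upper and a
    lower strand of the same eye: one of the two crossings has type M and the
    other does not. *)
Lemma crossing_weight_cusp u a c : a != c -> a \notin u ->
  crossing_weight u a c + crossing_weight (rcons u a) a c = 4.
Proof.
move=> ac au; rewrite /crossing_weight !mem_rcons !in_cons eqxx (negbTE au).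
by rewrite [c == a]eq_sym (negbTE ac) /=; case: (c \in u).
Qed.

Lemma paired_pair new s u a b v : paired new s ->
  perm_eq s (u ++ [:: a; b] ++ v) -> a = b -> a \notin u ++ v.
Proof. by move=> ps /paired_perm/(_ ps) + ab; rewrite -{}ab => /pairedR[]. Qed.

Lemma strip_R2 w w' new s (t := [:: false]) (t' := [:: false; false; false]) :
  reidemeister2 w w' -> paired new s -> fits (size s) w' ->
  run_ok true w' t' new s = run_ok true w t new s
  /\ (run_ok true w t new s ->
      [/\ run w' t' new s = run w t new s,
      weight w t new s = 0 & weight w' t' new s = 4]).
Proof.
rewrite {}/t {}/t'; case=> k ps /= fit.
- have hk : k < size s by case/andP: fit; lia.
  have [|u [v [es hu]]] := @split_at s k; first lia.
  case: v es => [|c v] es; first by move: hk; rewrite es size_cat /=; lia.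
  rewrite es in ps *; have := paired_new ps; rewrite mem_cat in_cons !negb_or.
  case/and3P=> nu nc nv.
  rewrite !(eventE hu, eventE1 _ hu) /= ?andbT.
  rewrite eq_sym nc; do 2 split=> //.
  rewrite ?addn0 ?add0n ![crossing_weight _ c _]crossing_weightC.
  by rewrite crossing_weight_cusp.
- have hk : k < size s by case/and3P: fit; lia.
  have [|u [v [es hu]]] := @split_at s k; first lia.
  case: v es => [|c v] es; first by move: hk; rewrite es size_cat /=; lia.
  rewrite es in ps *; have := paired_new ps; rewrite mem_cat in_cons !negb_or.
  case/and3P=> nu nc nv.
  rewrite !(eventE hu, eventE1 _ hu) /= ?andbT.
  rewrite nc; do 2 split=> //.
  by rewrite ?addn0 ?add0n addnC crossing_weight_cusp.
- have hk : k.+2 < size s by case/andP: fit; lia.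
  have [|u [a [b [v [es hu]]]]] := @split_at2 s k; first lia.
  case: v es => [|c v] es; first by move: hk; rewrite es size_cat /=; lia.
  rewrite es in ps *.
  have ab : a = b -> a != c /\ a \notin u.
    move/(paired_pair ps (perm_refl _)); rewrite mem_cat in_cons !negb_or.
    by case/and3P.
  rewrite !(eventE hu, eventE1 _ hu) /= ?andbT.
  case: (a =P b) ab => [<- [//|ac au]|_ _]; last by rewrite !andbF.
  rewrite ac; do 2 split=> //.
  by rewrite ?add0n ?addn0 addnC crossing_weight_cusp.
have hk : k.+2 < size s by case/and3P: fit; lia.
have [|u [c [a [v [es hu]]]]] := @split_at2 s k; first lia.
case: v es => [|b v] es; first by move: hk; rewrite es size_cat /=; lia.
rewrite es in ps *.
have ab : a = b -> a != c /\ a \notin u.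
  have p : perm_eq s (rcons u c ++ [:: a; b] ++ v) by rewrite es cat_rcons.
  move/(paired_pair ps); rewrite -es => /(_ _ _ p).
  by rewrite mem_cat mem_rcons in_cons !negb_or => /andP[/andP[]].
rewrite !(eventE hu, eventE1 _ hu) /= ?andbT.
case: (a =P b) ab => [<- [//|ac au]|_ _]; last by rewrite !andbF.
rewrite eq_sym ac; do 2 split=> //.
rewrite ?addn0 ?add0n ![crossing_weight _ c _]crossing_weightC.
by rewrite crossing_weight_cusp.
Qed.

Lemma strip_handle0 k new s (w := [:: 'L_k; 'R_k]) (t := [:: false; false]) :
  fits (size s) w ->
  [/\ run_ok true w t new s, run w t new s = s & weight w t new s = 0].
Proof.
rewrite /= addn0 => /andP[/split_at[u [v [-> hu]]] _].
by rewrite !(eventE hu) eqxx.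
Qed.

(** Surgery merges the eye that ends with the eye that is born.  The new label
    takes the name of the old one. *)
Lemma strip_handle1 k new s (w := [:: 'R_k; 'L_k]) (t := [:: false; false]) :
  paired new s -> run_ok true w t new s ->
  similar (run w t new s) s /\ weight w t new s = 0.
Proof.
rewrite {}/w {}/t /= => ps /andP[h _]; have := event_ok_pos h; rewrite addn2.
case/split_at2=> u [a [b [v [es hu]]]]; rewrite es in h ps *.
move: h; rewrite !(eventE hu) => /eqP ab; rewrite -{b es}ab in ps *.
split=> //; have [na /pairedS puv] := pairedR ps.
move: puv; set n := new.+1 => puv.
have gE z x : x \in u ++ v -> (if x == n then z else x) = x.
  by move=> xs; case: eqP => // E; have := paired_new puv; rewrite -E xs.
exists (fun x => if x == n then a else x); last first.
  rewrite map_cat /= eqxx; congr (_ ++ [:: _, _ & _]);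
  by rewrite -[LHS]map_id; apply/eq_in_map=> x xs; rewrite gE // mem_cat xs ?orbT.
have spl x : x \in u ++ [:: n, n & v] -> x = n \/ x \in u ++ v.
  by rewrite !mem_cat !in_cons => /or4P[->|/eqP|/eqP|->]; rewrite ?orbT; auto.
move=> x y /spl[->|hx] /spl[->|hy] //; rewrite ?eqxx ?gE // => E.
- by move: na; rewrite E hy.
- by move: na; rewrite -E hx.
Qed.

Lemma paired_absent new u l v x : paired new (u ++ l ++ v) ->
  1 < count_mem x l -> x \notin u.
Proof.
move=> ps xl; apply/negP=> xu.
have [] := ps x; first by rewrite mem_cat xu.
move: xu; rewrite !count_cat -has_pred1 has_count; lia.
Qed.

(** In a valid strip the three strands belong to three eyes.  Two pairs of them
    meet in any case; the third pair is kept apart by normality when the middle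
    crossing is a switch, and meets otherwise. *)
Lemma R3_distinct w p q r new k u a b c v :
    size u = k ->
    w = [:: 'X_k; 'X_k.+1; 'X_k] \/ w = [:: 'X_k.+1; 'X_k; 'X_k.+1] ->
    paired new (u ++ [:: a, b, c & v]) ->
    run_ok true w [:: p; q; r] new (u ++ [:: a, b, c & v]) ->
  [/\ a != b, b != c & a != c].
Proof.
move=> hu hw ps.
have absent x : 1 < (a == x) + ((b == x) + ((c == x) + 0)) -> x \notin u.
  by move=> h; apply: (@paired_absent new u [:: a; b; c] v).
case: hw => ->.
- rewrite /= !(eventE hu, eventE1 _ hu).
  case: p => /=; rewrite ?(eventE hu, eventE1 _ hu);
  case: q => /=; rewrite ?(eventE hu, eventE1 _ hu) ?andbT.
  + case/and3P=> /andP[ab _] /andP[bc n] _; split=> //.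
    apply/eqP=> ac; move: n; rewrite -ac eq_sym in bc *.
    by rewrite nested_rcons_neq 1?eq_sym // absent // -ac eqxx; case: (b == a).
  + by case/and3P=> /andP[ab _] bc /andP[ac _].
  + case/and3P=> ab /andP[ac n] _; split=> //.
    apply/eqP=> bc; move: n; rewrite -bc in ac *.
    by rewrite nested_rcons_neq // absent // -bc eqxx; case: (a == b).
  + by case/and3P=> ab ac /andP[bc _].
rewrite /= !(eventE hu, eventE1 _ hu).
case: p => /=; rewrite ?(eventE hu, eventE1 _ hu);
case: q => /=; rewrite ?(eventE hu, eventE1 _ hu) ?andbT.
+ case/and3P=> /andP[bc _] /andP[ab n] _; split=> //.
  apply/eqP=> ac; move: n; rewrite -ac.
  by rewrite nested_cons_neq // absent // -ac eqxx; case: (b == a).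
+ by case/and3P=> /andP[bc _] ab /andP[ac _].
+ case/and3P=> bc /andP[ac n] _; split=> //.
  apply/eqP=> ab; move: n; rewrite -ab.
  by rewrite nested_cons_neq // absent // -ab eqxx; case: (c == a).
by case/and3P=> bc ac /andP[ab _].
Qed.

(** The strands leave the strip in the same order before and after the move.  The
    choice between the two images of [[:: true; false; true]] depends on the
    eyes outside the strip, and normality after the move is then assumed. *)
Lemma strip_R3 w w' t t' new s :
    reidemeister3 w w' -> r3_switches t t' -> paired new s ->
    (t = [:: true; false; true] ->
     run_ok false w' t' new s -> similar (run w t new s) (run w' t' new s) ->
     run_ok true w' t' new s) ->
  run_ok true w t new s -> strip_equiv new s w t w' t'.
Proof.
move=> hw ht ps hpr ok.
have [k hk] : exists k, w = [:: 'X_k; 'X_k.+1; 'X_k] \/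
                        w = [:: 'X_k.+1; 'X_k; 'X_k.+1].
  by case: hw => k; exists k; auto.
have room : k.+2 < size s.
  by case: hk (fits_run ok) => -> /= /and3P[]; lia.
have [|u [a [b [v [es hu]]]]] := @split_at2 s k; first lia.
case: v es => [|c v] es; first by move: room; rewrite es size_cat /=; lia.
rewrite {s room}es in ps hpr ok *.
have [ab bc ac] : [/\ a != b, b != c & a != c].
  have [p [q [r et]]] : exists p q r, t = [:: p; q; r].
    by case: ht {hpr ok}; do 3 eexists.
  by rewrite et in ok; apply: (R3_distinct hu hk ps ok).
have ba : b != a by rewrite eq_sym.
have cb : c != b by rewrite eq_sym.
have ca : c != a by rewrite eq_sym.
have wba := crossing_weightC u b a; have wcb := crossing_weightC u c b.
have dab := crossing_weight_double u a b.
have dbc := crossing_weight_double u b c.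
have nt := @nested_trans u v.
have sim := similar_refl.
case: hw hk hpr ok => j hk;
  have ej : size u = j by rewrite hu; case: hk => -[]; lia.
all: case: ht => + ok; move: ok; rewrite /strip_equiv /=;
     rewrite !(eventE ej, eventE1 _ ej) /=;
     rewrite ?(nested_rcons, nested_cons, crossing_weight_rcons) //;
     rewrite ?(ab, bc, ac, ba, cb, ca) /= ?andbT.
all: try (move=> ok hpr; split=> //; try lia; move: ok;
  do ?[case/andP]; move=> *; rewrite ?andbT; do ?[apply/andP; split]; eauto).
(* What is left is the choice between the two images of a pair of switches. *)
all: by case/andP: (hpr erefl isT (sim _)).
Qed.

(** * Exchange of two consecutive events *)

(** The effect, the validity and the weight of an event of kind [t] in terms of
    the labels [x] of the strands that enter it, so that the nine pairs of kinds
    of events can be treated at once. *)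
Definition outgoing (t : event_kind) (sw : bool) (new : nat) (x : seq nat) :=
  match t with
  | LeftCusp => [:: new; new]
  | RightCusp => [::]
  | Crossing => if sw then x else rev x
  end.

Definition incoming_ok (t : event_kind) (sw : bool) (x : seq nat) : bool :=
  match t, x with
  | LeftCusp, [::] => ~~ sw
  | RightCusp, [:: a; b] => ~~ sw && (a == b)
  | Crossing, [:: a; b] => a != b
  | _, _ => false
  end.

Definition switch_ok (t : event_kind) (sw : bool) u (x : seq nat) v : bool :=
  if t is Crossing then sw ==> nested_at u (nth 0 x 0) (nth 0 x 1) v else true.

Definition local_weight (t : event_kind) (sw : bool) u (x : seq nat) : nat :=
  if t is Crossing then
    if sw then 0 else crossing_weight u (nth 0 x 0) (nth 0 x 1)
  else 0.

Section Chunk.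
Variables (u x v : seq nat) (t : event_kind) (k : nat).
Hypotheses (size_u : size u = k) (size_x : size x = fan_in t).

Lemma chunk_ok sw : event_ok true (Event t k) sw (u ++ x ++ v)
  = incoming_ok t sw x && switch_ok t sw u x v.
Proof.
by case: t size_x; case: x => [|a [|b []]] //= _; rewrite (eventE size_u) ?andbT.
Qed.

Lemma chunk_step sw new :
  step (Event t k) sw new (u ++ x ++ v) = u ++ outgoing t sw new x ++ v.
Proof.
case: t size_x; case: x => [|a [|b []]] //= _; rewrite (eventE size_u) //.
by case: sw.
Qed.

Lemma chunk_weight sw :
  event_weight (Event t k) sw (u ++ x ++ v) = local_weight t sw u x.
Proof.
by case: t size_x; case: x => [|a [|b []]] //= _; rewrite (eventE size_u).
Qed.

Lemma size_outgoing sw new : size (outgoing t sw new x) = fan_out t.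
Proof. by case: t size_x => //= <-; case: sw; rewrite ?size_rev. Qed.

End Chunk.

Lemma index_filter (T : eqType) (p : pred T) (a b : T) v : p a -> p b ->
  (index b (filter p v) < index a (filter p v)) = (index b v < index a v).
Proof.
move=> pa pb; elim: v => //= y v IH; case: ifP => /= py.
  by do 2 case: eqP => //.
rewrite IH; case: eqP py => [->|_]; rewrite ?pb //.
by case: eqP => [->|]; rewrite ?pa.
Qed.

(** Only the strands of the two eyes matter for the normality of a switch, which
    therefore does not notice events of other eyes. *)
Lemma nested_at_filter u u' a b v v' (p := [pred z in [:: a; b]]) :
  filter p u = filter p u' -> filter p v = filter p v' ->
  nested_at u a b v = nested_at u' a b v'.
Proof.
move=> uu vv; have pa : p a by rewrite !inE eqxx.
have pb : p b by rewrite !inE eqxx orbT.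
have hm z : p z -> (z \in u) = (z \in u').
  by move=> pz; have := mem_filter p z u'; rewrite -uu mem_filter pz.
have hi w w' : filter p w = filter p w' ->
    (index b w < index a w) = (index b w' < index a w').
  by move=> E; rewrite -(index_filter w pa pb) E index_filter.
by rewrite /nested_at !hm // (hi _ _ uu) (hi _ _ vv).
Qed.

Lemma filter_outgoing t sw new x (p : pred nat) :
  incoming_ok t sw x -> ~~ p new ->
  (t = RightCusp -> ~~ has p x) ->
  (t = Crossing -> ~~ sw -> ~~ all p x) ->
  filter p (outgoing t sw new x) = filter p x.
Proof.
case: t; case: x => [|a [|b []]] //=.
- by move=> _ /negbTE ->.
- move=> _ _ /(_ erefl) + _; rewrite orbF negb_or.
  by case/andP=> /negbTE -> /negbTE ->.
move=> _ _ _ /(_ erefl); case: sw => //= /(_ isT).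
by rewrite andbT /rev /=; case: (p a); case: (p b).
Qed.

Lemma mem_outgoing t sw new x z :
  incoming_ok t sw x -> z != new -> (t = RightCusp -> z \notin x) ->
  (z \in outgoing t sw new x) = (z \in x).
Proof.
case: t; case: x => [|a [|b []]] //=.
- by move=> _ /negbTE zn; rewrite !inE zn.
- by move=> _ _ /(_ erefl)/negbTE ->.
by case: sw => // _ _ _; rewrite mem_rev.
Qed.

Definition transposition (a b z : nat) : nat :=
  if z == a then b else if z == b then a else z.

Lemma transpositionK a b : involutive (transposition a b).
Proof.
move=> z; rewrite /transposition; case: (z =P a) => [->|/eqP za].
  by rewrite eqxx; case: eqP.
by case: (z =P b) => [->|/eqP zb]; rewrite ?eqxx // (negbTE za) (negbTE zb).
Qed.

Lemma map_outgoing (g : nat -> nat) t sw new x :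
  map g (outgoing t sw new x) = outgoing t sw (g new) (map g x).
Proof. by case: t; case: sw; rewrite //= map_rev. Qed.

Lemma map_transposition_id a b s : a \notin s -> b \notin s ->
  map (transposition a b) s = s.
Proof.
move=> ha hb; rewrite -[RHS]map_id; apply/eq_in_map=> z zs.
rewrite /transposition; case: eqP => [E|_]; first by rewrite -E zs in ha.
by case: eqP => [E|//]; rewrite -E zs in hb.
Qed.

Section Exchange.
Variables (l h : event_kind) (j k new : nat) (u x m y v : seq nat).
Hypotheses (size_u : size u = j) (size_x : size x = fan_in l)
  (size_uxm : size (u ++ x ++ m) = k) (size_y : size y = fan_in h).
Let s := u ++ x ++ m ++ y ++ v.
Hypothesis ps : paired new s.
Let k' := k - fan_in l + fan_out l.
Let low_first := [:: Event l j; Event h k'].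
Let high_first := [:: Event h k; Event l j].

Let size_shifted a n : size (u ++ outgoing l a n x ++ m) = k'.
Proof.
by rewrite /k' -size_uxm !size_cat size_x (size_outgoing size_x); lia.
Qed.

Lemma low_firstE (a b : bool) (x' := outgoing l a new x) :
  [/\ run_ok true low_first [:: a; b] new s =
      [&& incoming_ok l a x, switch_ok l a u x (m ++ y ++ v),
          incoming_ok h b y & switch_ok h b (u ++ x' ++ m) y v],
     run low_first [:: a; b] new s = u ++ x' ++ m ++ outgoing h b new.+1 y ++ v
   & weight low_first [:: a; b] new s =
      local_weight l a u x + local_weight h b (u ++ x' ++ m) y].
Proof.
rewrite /= (chunk_ok _ size_u size_x) (chunk_step _ size_u size_x).
have -> : u ++ outgoing l a new x ++ m ++ y ++ v
        = (u ++ x' ++ m) ++ y ++ v by rewrite -!catA.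
rewrite (chunk_ok _ (size_shifted _ _) size_y).
rewrite (chunk_step _ (size_shifted _ _) size_y).
rewrite (chunk_weight _ (size_shifted _ _) size_y).
by rewrite (chunk_weight _ size_u size_x) -!catA andbT -!andbA addn0.
Qed.

Lemma high_firstE (a b : bool) (y' := outgoing h b new y) :
  [/\ run_ok true high_first [:: b; a] new s =
      [&& incoming_ok h b y, switch_ok h b (u ++ x ++ m) y v,
          incoming_ok l a x & switch_ok l a u x (m ++ y' ++ v)],
     run high_first [:: b; a] new s = u ++ outgoing l a new.+1 x ++ m ++ y' ++ v
   & weight high_first [:: b; a] new s =
      local_weight l a u x + local_weight h b (u ++ x ++ m) y].
Proof.
have sE : s = (u ++ x ++ m) ++ y ++ v by rewrite /s -!catA.
rewrite /= sE (chunk_ok _ size_uxm size_y) (chunk_step _ size_uxm size_y).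
rewrite (chunk_weight _ size_uxm size_y) -!catA.
rewrite (chunk_ok _ size_u size_x) (chunk_step _ size_u size_x).
by rewrite (chunk_weight _ size_u size_x) -!andbA andbT addn0 addnC.
Qed.

(** The labels of two exchanged left cusps are exchanged. *)
Lemma exchange_similar a b :
  similar (run low_first [:: a; b] new s) (run high_first [:: b; a] new s).
Proof.
have [_ -> _] := low_firstE a b; have [_ -> _] := high_firstE a b.
exists (transposition new new.+1).
  by move=> z z' _ _; apply: inv_inj (transpositionK _ _) _ _.
have := paired_new ps; have := paired_new (pairedS ps).
rewrite /s !mem_cat !negb_or => /and5P[? ? ? ? ?] /and5P[? ? ? ? ?].
rewrite !map_cat !map_outgoing !map_transposition_id //.
by rewrite /transposition !eqxx; case: eqP => // /esym/n_Sn.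
Qed.

(** A switch between two eyes is only affected by a crossing of the same two
    eyes, which the hypothesis excludes. *)
Lemma exchange_plain a b :
    ([&& is_crossing (Event l j), is_crossing (Event h k) & a (+) b] ->
     ~~ all (mem x) y) ->
  run_ok true low_first [:: a; b] new s
    = run_ok true high_first [:: b; a] new s
  /\ (run_ok true low_first [:: a; b] new s ->
      weight low_first [:: a; b] new s = weight high_first [:: b; a] new s).
Proof.
move=> no_swap; have [-> _ ->] := low_firstE a b.
have [-> _ ->] := high_firstE a b.
case okx: (incoming_ok l a x); last by rewrite /= !andbF.
case oky: (incoming_ok h b y); last by rewrite /= !andbF.
rewrite !andTb andbC; have := paired_new ps.
rewrite /s !mem_cat !negb_or => /and5P[_ nx _ ny _].
have newx z : z \in x -> z != new by move=> zx; apply: contraNneq nx => <-.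
have newy z : z \in y -> z != new by move=> zy; apply: contraNneq ny => <-.
have xR : l = RightCusp -> {in y, forall z, z \notin x}.
  move=> E z zy; move: okx ps; rewrite /s E.
  case: x => [|c [|d []]] //= /andP[_ /eqP <-] /pairedR[+ _].
  rewrite !mem_cat !inE orbb !negb_or => /and4P[_ _ cy _].
  by apply: contraNneq cy => <-.
have yR : h = RightCusp -> {in x, forall z, z \notin y}.
  move=> E z zx; move: oky ps; rewrite /s E.
  case: y => [|c [|d []]] //= /andP[_ /eqP <-].
  rewrite !catA => /pairedR[+ _].
  rewrite !mem_cat !inE orbb !negb_or => /andP[/andP[/andP[_ cx] _] _].
  by apply: contraNneq cx => <-.
have swx : switch_ok l a u x (m ++ y ++ v)
         = switch_ok l a u x (m ++ outgoing h b new y ++ v).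
  rewrite /switch_ok; case: (l) okx no_swap newx yR => //.
  case: x => [|c [|d []]] //= cd no_swap newx yR; case: a no_swap => //= no_swap.
  apply: nested_at_filter => //; rewrite !filter_cat; congr (_ ++ (_ ++ _)).
  apply/esym/filter_outgoing => //=.
  - by apply/negP=> /newx; rewrite eqxx.
  - by move=> /yR hy; apply/hasPn=> z; apply: contraL => /= /hy.
  by move=> hX; move: no_swap; rewrite hX /=.
rewrite {}swx.
have swy : switch_ok h b (u ++ outgoing l a new x ++ m) y v
         = switch_ok h b (u ++ x ++ m) y v.
  rewrite /switch_ok; case: (h) oky no_swap newy xR => //.
  case: y => [|c [|d []]] //= cd no_swap newy xR; case: b no_swap => //= no_swap.
  apply: nested_at_filter => //; rewrite !filter_cat; congr (_ ++ (_ ++ _)).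
  apply/filter_outgoing => //=.
  - by apply/negP=> /newy; rewrite eqxx.
  - by move=> /xR hy; apply/hasPn=> z; apply: contraL => /= /hy.
  move=> lX na; move: okx no_swap; rewrite lX /= addbT na /= => + /(_ isT).
  case: (x) => [|e [|f []]] //= ef; apply: contra.
  rewrite !inE !andbT => /andP[/orP[]/eqP ? /orP[]/eqP ?]; subst;
    by rewrite ?eqxx ?orbT // in ef *.
rewrite {}swy andbC; split=> // _; congr (_ + _).
rewrite /local_weight; clear no_swap; case: (h) oky newy xR => //.
case: y => [|c [|d []]] //= cd newy xR; case: b => //.
have mem_c z : z \in [:: c; d] ->
    (z \in u ++ outgoing l a new x ++ m) = (z \in u ++ x ++ m).
  move=> zy; rewrite !mem_cat mem_outgoing //; first exact: newy.
  by move/xR; apply.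
by rewrite /crossing_weight !mem_c // !inE eqxx ?orbT.
Qed.

(** The four strands belong to two eyes, and the normality of the switch forces
    one eye to lie inside the other there.  Hence the crossing, which joins two
    upper or two lower strands both before and after, has weight 1.  The two eyes
    leave the strip with their labels exchanged. *)
Lemma exchange_swap a b : l = Crossing -> h = Crossing -> a (+) b ->
    all (mem x) y -> incoming_ok l a x -> incoming_ok h b y ->
  [/\ run_ok true low_first [:: a; b] new s
        = run_ok true high_first [:: ~~ b; ~~ a] new s,
      weight low_first [:: a; b] new s
        = weight high_first [:: ~~ b; ~~ a] new s
    & similar (run low_first [:: a; b] new s)
              (run high_first [:: ~~ b; ~~ a] new s)].
Proof.
move=> lX hX; have [-> -> ->] := low_firstE a b.
have [-> -> ->] := high_firstE (~~ a) (~~ b).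
move: ps; rewrite /s lX hX; case: x => [|c [|d []]] //.
case: y => [|e [|f []]] // pcd ab yx; rewrite /= => cd ef.
have perm p : perm_eq [:: c; d] p ->
    perm_eq (u ++ [:: c; d] ++ m ++ p ++ v) [:: c, c, d, d & u ++ m ++ v].
  move/permP=> hp; apply/permP=> q; have := hp q.
  rewrite !count_cat /= !count_cat => <-.
  move: (nat_of_bool (q c)) (nat_of_bool (q d)).
  by move: (count q u) (count q m) (count q v); lia.
have absent p : perm_eq [:: c; d] p ->
    paired new (u ++ [:: c; d] ++ m ++ p ++ v) ->
    c \notin u ++ m ++ v /\ d \notin u ++ m ++ v.
  move=> /perm/paired_perm pp /pp /(@pairedR _ [::])[].
  by rewrite /= !in_cons !negb_or => /and3P[_ _ ->] /(@pairedR _ [::])[-> _].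
have dc : (d == c) = false by rewrite eq_sym (negbTE cd).
have [[ec fd]|[ec fd]] : (e = c /\ f = d) \/ (e = d /\ f = c).
  move: yx ef; rewrite /= !inE andbT.
  case/andP=> /orP[]/eqP -> /orP[]/eqP ->; rewrite ?eqxx //; auto.
all: rewrite {e}ec {f}fd in pcd ef yx *.
all: have [|hc hd] := absent _ _ pcd;
  [by rewrite ?perm_refl // (perm_catC [:: c] [:: d])|].
all: move: hc hd; rewrite !mem_cat !negb_or.
all: move=> /and3P[/negbTE cu /negbTE cm /negbTE cv].
all: move=> /and3P[/negbTE du /negbTE dm /negbTE dv].
all: have tE z : c \notin z -> d \notin z -> map (transposition c d) z = z by
  apply: map_transposition_id.
all: have [tc td] : transposition c d c = d /\ transposition c d d = c by
  rewrite /transposition !eqxx dc.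
all: have ti : injective (transposition c d) by
  apply: inv_inj (transpositionK c d).
all: case: a ab; case: b => // _; rewrite /= /rev /=; split;
  try (by exists (transposition c d) => [z z' _ _ /ti //|];
    rewrite !(map_cat, map_cons) /= tc td !tE ?cu ?cm ?cv ?du ?dm ?dv);
  rewrite /nested_at /crossing_weight ?mem_cat ?inE ?cu ?cm ?du ?dm;
  rewrite ?index_cat ?cu ?cm ?du ?dm ?inE ?eqxx ?dc ?(negbTE cd) /=;
  rewrite ?eqxx ?dc ?(negbTE cd) /=; try lia.
Qed.

End Exchange.

(** * Components of the resolution and labels *)

Lemma nth_crossing_step e sw new s k :
  kind e = Crossing -> pos e + 2 <= size s -> k < size s ->
  nth 0 (step e sw new s) k =
  nth 0 s (if sw then k else if k == pos e then k.+1
           else if k == (pos e).+1 then k.-1 else k).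
Proof.
case: e => t p /= -> hp hk; rewrite /step /=; case: sw => //.
rewrite nth_cat size_takel; last lia.
case: ltnP => kp; first by rewrite nth_take // !ifN //; lia.
case: eqP => [->|kp1]; first by rewrite subnn.
case: eqP => [->|kp2]; first by rewrite subSnn.
have -> : k - p = (k - p.+2).+2 by lia.
by rewrite /= nth_drop; congr nth; lia.
Qed.

Lemma nth_lcusp_step e sw new s k : kind e = LeftCusp -> pos e <= size s ->
  nth 0 (step e sw new s) k =
  if k < pos e then nth 0 s k
  else if k < (pos e).+2 then new else nth 0 s (k - 2).
Proof.
case: e => t p /= -> hp; rewrite /step /= nth_cat size_takel //.
case: ltnP => kp; first by rewrite nth_take.
case: ltnP => kp2.
  have: k - p < 2 by lia.
  by case: (k - p) => [|[|]].
have -> : k - p = (k - p.+2).+2 by lia.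
by rewrite /= nth_drop; congr nth; lia.
Qed.

Lemma nth_rcusp_step e sw new s k : kind e = RightCusp -> pos e + 2 <= size s ->
  nth 0 (step e sw new s) k = nth 0 s (if k < pos e then k else k.+2).
Proof.
case: e => t p /= -> hp; rewrite /step /= nth_cat size_takel; last lia.
case: ltnP => kp; first by rewrite nth_take.
by rewrite nth_drop; congr nth; lia.
Qed.

Lemma through_step n e sw new s k l : event_ok n e sw s -> k < size s ->
  through e sw k = Some l ->
  l < size (step e sw new s) /\ nth 0 (step e sw new s) l = nth 0 s k.
Proof.
move=> h; rewrite (size_step _ h); have := event_ok_pos h; rewrite /through.
case E: (kind e) => /= hp hk.
- rewrite nth_lcusp_step //; last lia.
  case: ltnP => kp [<-]; split; try lia; first by rewrite kp.
  by rewrite !ifN; try lia; congr nth; lia.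
- case: ltnP => kp; [|case: ltnP => kp2 //]; case=> <-;
    rewrite nth_rcusp_step //; split; try lia.
    by rewrite kp.
  by congr nth; rewrite ifN; lia.
case=> <-; set l' := (X in X < _); have hl : l' < size s.
  by rewrite /l'; do ?case: ifP => ?; lia.
split; first lia.
rewrite nth_crossing_step //; congr nth; rewrite {}/l' in hl *; case: (sw) => //.
case: (k =P pos e) => [->|n1]; first by rewrite ifN ?eqxx //; lia.
case: (k =P (pos e).+1) => [->|n2]; first by rewrite eqxx.
by rewrite !ifN //; lia.
Qed.

Lemma through_onto n e sw new s l : event_ok n e sw s ->
  l < size (step e sw new s) ->
  (exists2 k, k < size s & through e sw k = Some l)
  \/ [/\ is_lcusp e, l = pos e \/ l = (pos e).+1
       & nth 0 (step e sw new s) l = new].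
Proof.
move=> h; rewrite (size_step _ h); have := event_ok_pos h.
rewrite /through /is_lcusp; case E: (kind e) => /= hp hl.
- case: (ltnP l (pos e)) => l1; first by left; exists l; rewrite ?l1 //; lia.
  case: (ltnP l (pos e).+2) => l2; [right|left].
    split=> //; first lia.
    by rewrite nth_lcusp_step //; [rewrite l2 ifN //; lia | lia].
  by exists (l - 2); [lia | rewrite ifN; [congr Some|]; lia].
- left; case: (ltnP l (pos e)) => l1; first by exists l; rewrite ?l1 //; lia.
  by exists l.+2; [lia | rewrite !ifN; [congr Some| |]; lia].
left; case: sw {h}; first by exists l => //; lia.
case: (l =P pos e) => [->|n1].
  exists (pos e).+1; first lia.
  by rewrite ifN ?eqxx //; lia.
case: (l =P (pos e).+1) => [->|n2].
  by exists (pos e); rewrite ?eqxx //; lia.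
by exists l; [lia | rewrite !ifN //; lia].
Qed.

(** Numbering events from 0 labels each eye by the position of its left cusp. *)
Definition state (D : diagram) (rho : bitseq) (i : nat) : seq nat :=
  run (take i D) (take i rho) 0 [::].

Section Bridge.
Variables (D : diagram) (rho : bitseq).
Hypothesis ok : run_ok false D rho 0 [::].

Let size_rho : size rho = size D. Proof. exact: run_ok_size ok. Qed.

Lemma stateS i : i < size D ->
  state D rho i.+1 = step (ev D i) (switch rho i) i (state D rho i).
Proof.
move=> hi; rewrite /state (take_nth ('X_0) hi) (take_nth false) ?size_rho //.
rewrite -!cats1 run_cat; last by rewrite !size_takel ?size_rho // ltnW.
by rewrite add0n size_takel // ltnW.
Qed.

Lemma run_ok_state n i : run_ok n D rho 0 [::] -> i < size D ->
  event_ok n (ev D i) (switch rho i) (state D rho i).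
Proof.
move=> okn hi; move: okn.
rewrite -{1}(cat_take_drop i D) -{1}(cat_take_drop i rho).
rewrite run_ok_cat; last by rewrite !size_takel ?size_rho // ltnW.
by rewrite (drop_nth ('X_0) hi) (drop_nth false) ?size_rho //= => /and3P[].
Qed.

Lemma ok_state i : i < size D ->
  event_ok false (ev D i) (switch rho i) (state D rho i).
Proof. exact: run_ok_state. Qed.

Lemma paired_state i : i <= size D -> paired i (state D rho i).
Proof.
elim: i => [|i IH] hi; first by rewrite /state !take0.
by rewrite stateS //; apply: paired_step (ok_state hi) (IH (ltnW hi)).
Qed.

Lemma width_state i : i <= size D -> width D i = size (state D rho i).
Proof.
elim: i => [|i IH] hi; first by rewrite /width /state !take0.
rewrite stateS // (size_step _ (ok_state hi)) -IH; last exact: ltnW.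
by rewrite /width (take_nth ('X_0) hi) foldl_rcons.
Qed.

Lemma size_state i : i <= size D -> size (state D rho i) <= i.*2.
Proof.
elim: i => [|i IH] hi; first by rewrite /state !take0.
rewrite stateS // (size_step _ (ok_state hi)); have := IH (ltnW hi).
by case: (kind _) => /=; lia.
Qed.

Definition on_slice (i k : nat) : bool :=
  (i <= size D) && (k < size (state D rho i)).

Definition label (i k : nat) : nat := nth 0 (state D rho i) k.

Lemma pt_val i k : on_slice i k -> val (pt D i k).1 = i /\ val (pt D i k).2 = k.
Proof.
by case/andP=> hi hk; rewrite /= !inordK //; have := size_state hi; lia.
Qed.

Lemma pt_eta (x : point D) : pt D x.1 x.2 = x.
Proof. by case: x => i k; rewrite /pt !inord_val. Qed.

Lemma joined_label i k j l : i <= size D -> joined D rho (i, k) (j, l) ->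
  [/\ on_slice i k, on_slice j l & label i k = label j l].
Proof.
move=> hi; rewrite /on_slice /label /= => /or3P[].
- case/and4P=> ltiD kw /eqP-> /eqP thr; rewrite width_state // in kw.
  have [lt eq] := through_step i (ok_state ltiD) kw thr.
  by rewrite hi kw stateS // eq; split=> //; rewrite ltiD.
- case/and5P; case: i hi => // i hi _ /eqP -> lc /eqP -> /eqP ->.
  rewrite /= in lc *; have := event_ok_pos (ok_state hi).
  move: lc; rewrite /is_lcusp; case E: (kind _) => //= _; rewrite addn0 => hp.
  rewrite hi stateS // (size_step _ (ok_state hi)) E /=.
  split; [lia | lia |].
  have le_p p : ((p < p) = false) * ((p < p.+2) = true) * ((p.+1 < p) = false).
    by split; [split|]; lia.
  by rewrite !nth_lcusp_step // !le_p ltnSn.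
case/and5P=> ltiD /eqP -> rc /eqP -> /eqP ->.
have := ok_state ltiD; rewrite /event_ok.
move: rc; rewrite /is_rcusp; case: (kind _) => //= _ /and3P[hp _ /eqP ->].
by rewrite hi; split=> //; lia.
Qed.

Lemma adjacent_label (x y : point D) : adjacent rho x y ->
  [/\ on_slice x.1 x.2, on_slice y.1 y.2 & label x.1 x.2 = label y.1 y.2].
Proof.
have slice_le (z : point D) : val z.1 <= size D by rewrite -ltnS ltn_ord.
by case/orP=> /joined_label[].
Qed.

Lemma connect_label (x y : point D) : on_slice x.1 x.2 ->
  connect (adjacent rho) x y ->
  on_slice y.1 y.2 /\ label x.1 x.2 = label y.1 y.2.
Proof.
move=> hx /connectP[p]; elim: p x hx => [|z p IH] x hx /=; first by move=> _ ->.
by case/andP=> /adjacent_label[_ hz ->] /IH; apply.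
Qed.

Lemma connect_adjacent_sym : connect_sym (@adjacent D rho).
Proof. by apply: sym_connect_sym => x y; rewrite /adjacent orbC. Qed.

Lemma joined_adjacent i k j l : on_slice i k -> on_slice j l ->
  joined D rho (i, k) (j, l) -> adjacent rho (pt D i k) (pt D j l).
Proof.
move=> /pt_val[h1 h2] /pt_val[h3 h4]; rewrite /adjacent.
by move: h1 h2 h3 h4 => /= -> -> -> -> ->.
Qed.

(** Following a strand to the left leads to the left cusp of its eye. *)
Lemma connect_birth i k : on_slice i k ->
  connect (adjacent rho)
    (pt D (label i k).+1 (pos (ev D (label i k)))) (pt D i k).
Proof.
elim: i k => [|i IH] k; first by rewrite /on_slice /state !take0.
move=> hk; have /andP[hi] := hk; have oki := ok_state hi.
rewrite /label stateS // => lt_k.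
case: (through_onto oki lt_k) => [[l hl thr] | [lc hpos ->]].
  have [_ ->] := through_step i oki hl thr.
  have hl' : on_slice i l by rewrite /on_slice ltnW.
  apply: connect_trans (IH _ hl') (connect1 (joined_adjacent hl' hk _)).
  by rewrite /joined hi (width_state (ltnW hi)) hl thr !eqxx.
have hp : on_slice i.+1 (pos (ev D i)).
  rewrite /on_slice hi stateS //=.
  by case: hpos lt_k => -> //; apply: ltnW.
case: hpos => kE; first by rewrite kE connect0.
apply/connect1/joined_adjacent => //; apply/orP; right; apply/orP; left.
by rewrite /= hi !eqxx lc kE eqxx.
Qed.

Lemma connect_pt i k j l : on_slice i k -> on_slice j l ->
  connect (adjacent rho) (pt D i k) (pt D j l) = (label i k == label j l).
Proof.
move=> hik hjl; apply/idP/eqP => [con | E].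
  have [ei ek] := pt_val hik; have [ej el] := pt_val hjl.
  by have [] := connect_label _ con; rewrite ei ek ?ej ?el.
apply: connect_trans (connect_birth hjl); rewrite connect_adjacent_sym -E.
exact: connect_birth.
Qed.

Lemma component_atE i k j l : on_slice i k -> on_slice j l ->
  (component_at D rho i k == component_at D rho j l) = (label i k == label j l).
Proof.
move=> hik hjl; rewrite -connect_pt //; apply/eqP/idP => [E | con].
  have: pt D j l \in component_at D rho j l by rewrite inE connect0.
  by rewrite -E inE.
apply/setP=> x; rewrite !inE; apply: same_connect => //.
exact: connect_adjacent_sym.
Qed.

Lemma mem_component_at i k j l : on_slice i k -> on_slice j l ->
  (pt D j l \in component_at D rho i k) = (label i k == label j l).
Proof. by move=> *; rewrite inE connect_pt. Qed.

Lemma components_at C :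
  reflect (exists i k, on_slice i k /\ C = component_at D rho i k)
          (C \in components D rho).
Proof.
apply: (iffP imsetP) => [[x] | [i [k [h ->]]]].
  rewrite inE => hx ->; exists x.1, x.2; rewrite /component_at pt_eta; split=> //.
  by rewrite /on_slice -ltnS ltn_ord /= -width_state // -ltnS ltn_ord.
exists (pt D i k) => //; rewrite inE; have [-> ->] := pt_val h.
by case/andP: h => hi; rewrite width_state.
Qed.

Definition occurrences (c : nat) (s : seq nat) : seq nat :=
  [seq k <- iota 0 (size s) | nth 0 s k == c].

Lemma heights_occurrences i k j : on_slice i k -> j <= size D ->
  heights (component_at D rho i k) j = occurrences (label i k) (state D rho j).
Proof.
move=> h hj; rewrite /heights /occurrences width_state //.
apply: eq_in_filter => l; rewrite mem_iota => /andP[_ hl].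
have hjl : on_slice j l by rewrite /on_slice hj.
by rewrite mem_component_at // eq_sym.
Qed.

End Bridge.

(** * Sums over maximal runs *)

Section Intervals.
Variables (n : nat -> bool) (N : nat).
Hypotheses (n0 : ~~ n 0) (nN : ~~ n N).

Definition maximal_run (l r : nat) : bool :=
  [&& l < r, ~~ n l, all n (iota l.+1 (r - l)) & ~~ n r.+1].

Lemma maximal_runP l r :
  reflect [/\ l < r, ~~ n l, forall i, l < i <= r -> n i & ~~ n r.+1]
          (maximal_run l r).
Proof.
apply: (iffP and4P) => -[lr nl h nr]; split=> //.
  by move=> i hi; apply: (allP h); rewrite mem_iota; lia.
by apply/allP=> i; rewrite mem_iota => hi; apply: h; lia.
Qed.

Lemma run_end_unique l r r' : maximal_run l r -> maximal_run l r' -> r = r'.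
Proof.
move=> /maximal_runP[lr _ h nr] /maximal_runP[lr' _ h' nr'].
case: (ltngtP r r') => // hr.
- by move: nr; rewrite h' //; lia.
- by move: nr'; rewrite h //; lia.
Qed.

Lemma run_start_unique l l' r : maximal_run l r -> maximal_run l' r -> l = l'.
Proof.
move=> /maximal_runP[lr nl h _] /maximal_runP[lr' nl' h' _].
case: (ltngtP l l') => // hr.
- by move: nl'; rewrite h //; lia.
- by move: nl; rewrite h' //; lia.
Qed.

Lemma run_from_start l : l < N -> ~~ n l -> n l.+1 ->
  exists2 r, r < N & maximal_run l r.
Proof.
move=> lN nl nl1.
have neN : l.+1 != N by apply: contraNneq nN => <-.
have ex : exists r, (l < r) && ~~ n r.+1.
  by exists N.-1; rewrite prednK ?nN; lia.
case: (ex_minnP ex) => r /andP[lr nr] rmin; exists r.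
  have := rmin N.-1; rewrite prednK ?nN; last lia.
  by move=> /(_ ltac:(lia)); lia.
apply/maximal_runP; split=> // i hi; apply: contraT => ni.
have i1 : i != l.+1 by apply: contraNneq ni => ->.
have := rmin i.-1; rewrite prednK ?ni ?andbT; last lia.
by move=> /(_ ltac:(lia)); lia.
Qed.

Lemma run_from_end r : r < N -> n r -> ~~ n r.+1 ->
  exists2 l, l < N & maximal_run l r.
Proof.
move=> rN nr nr1.
have r0 : r != 0 by apply: contraTneq nr => ->.
have ex : exists l, (l < r) && ~~ n l by exists 0; rewrite n0; lia.
have ub l : (l < r) && ~~ n l -> l <= r by case/andP=> /ltnW.
case: (ex_maxnP ex ub) => l /andP[lr nl] lmax; exists l; first lia.
apply/maximal_runP; split=> // i hi; apply: contraT => ni.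
have ir : i != r by apply: contraNneq ni => ->.
have := lmax i; rewrite ni andbT => /(_ ltac:(lia)); lia.
Qed.

Lemma sum_unique (I : finType) (P : pred I) : 
  (forall i j, P i -> P j -> i = j) -> \sum_(i | P i) 1 = [exists i, P i].
Proof.
move=> uniqP; case: existsP => [[i Pi]|nP].
  rewrite (bigD1 i) //= big1 // => j /andP[Pj /eqP[]]; exact: uniqP.
by rewrite big1 // => i Pi; case: nP; exists i.
Qed.

(** Each place where [n] changes is an end of exactly one maximal run. *)
Lemma sum_runs (f : nat -> nat) :
  \sum_(I : 'I_N * 'I_N | maximal_run I.1 I.2) (f I.1 + f I.2)
  = \sum_(i < N) (n i (+) n i.+1) * f i.
Proof.
have starts (l : 'I_N) :
    \sum_(r : 'I_N | maximal_run l r) 1 = ~~ n l && n l.+1.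
  rewrite sum_unique => [|r r' h /(run_end_unique h)/val_inj //].
  congr nat_of_bool; apply/existsP/andP => [[r /maximal_runP[lr nl h _]]|[nl nl1]].
    by rewrite nl h //; lia.
  have [r rN h] := run_from_start (ltn_ord l) nl nl1.
  by exists (Ordinal rN).
have ends (r : 'I_N) :
    \sum_(l : 'I_N | maximal_run l r) 1 = n r && ~~ n r.+1.
  rewrite sum_unique => [|l l' h /(run_start_unique h)/val_inj //].
  congr nat_of_bool; apply/existsP/andP => [[l /maximal_runP[lr nl h nr]]|[nr nr1]].
    by rewrite nr h //; lia.
  have [l lN h] := run_from_end (ltn_ord r) nr nr1.
  by exists (Ordinal lN).
rewrite big_split /=.
have -> : \sum_(I : 'I_N * 'I_N | maximal_run I.1 I.2) f I.1
        = \sum_(l < N) (~~ n l && n l.+1) * f l.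
  rewrite (eq_bigl (fun I : 'I_N * 'I_N =>
                      xpredT I.1 && maximal_run I.1 I.2)) //.
  rewrite -(pair_big_dep xpredT (fun l r : 'I_N => maximal_run l r)
    (fun l _ => f l)).
  apply: eq_bigr => l _ /=; rewrite -starts big_distrl /=.
  by apply: eq_bigr => r _; rewrite mul1n.
have -> : \sum_(I : 'I_N * 'I_N | maximal_run I.1 I.2) f I.2
        = \sum_(r < N) (n r && ~~ n r.+1) * f r.
  rewrite (eq_bigl (fun I : 'I_N * 'I_N =>
                      xpredT I.1 && maximal_run I.1 I.2)) //.
  rewrite -(pair_big_dep xpredT (fun l r : 'I_N => maximal_run l r)
    (fun _ r => f r)).
  rewrite (exchange_big_dep xpredT) //=.
  apply: eq_bigr => r _ /=; rewrite -ends big_distrl /=.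
  by apply: eq_bigr => l _; rewrite mul1n.
rewrite -big_split /=; apply: eq_bigr => i _; rewrite -mulnDl.
by case: (n i); case: (n i.+1).
Qed.

(** A run with ends of weights [1 + 2 * m l] and [1 + 2 * m r] contributes
    [2 + 2 * (m l + m r)], which is 2 modulo 4 if [m l = m r] and 0 otherwise. *)
Lemma clasps_mod4 (m : nat -> bool) :
  2 * #|[set I : 'I_N * 'I_N | maximal_run I.1 I.2 && ~~ (m I.1 (+) m I.2)]|
  = \sum_(i < N) (n i (+) n i.+1) * (1 + 2 * m i) %[mod 4].
Proof.
rewrite -(sum_runs (fun i => 1 + 2 * m i)) -sum1dep_card big_mkcondr /=.
rewrite big_distrr /=.
elim/big_ind2: _ => // [a b c d|I _]; first lia.
by case: (m I.1); case: (m I.2).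
Qed.

End Intervals.

Lemma sum_pairs (T : finType) (A : {set T}) (a b : T) :
  a \in A -> b \in A -> a != b ->
  \sum_(E in A) \sum_(F in A | enum_rank E < enum_rank F)
     ((E == a) && (F == b) || (E == b) && (F == a)) = 1.
Proof.
move=> aA bA ab.
have [c [d [cA dA cd eqE]]] : exists c d, [/\ c \in A, d \in A,
    enum_rank c < enum_rank d & forall E F,
      ((E == a) && (F == b) || (E == b) && (F == a))
      = ((E == c) && (F == d) || (E == d) && (F == c))].
  have: enum_rank a != enum_rank b by rewrite (inj_eq enum_rank_inj).
  rewrite neq_ltn => /orP[]; first by exists a, b.
  by exists b, a; split=> // E F; rewrite orbC.
rewrite (bigD1 c) //= (bigD1 d) ?dA //= eqE !eqxx /=.
rewrite big1 => [|F /andP[_ /negbTE Fd]].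
  rewrite big1 ?addn0 // => E /andP[_ /negbTE Ec].
  rewrite big1 // => F /andP[_ EF]; rewrite eqE Ec /=.
  case: eqP => //= Ed; case: eqP => //= Fc.
  by move: EF; rewrite Ed Fc ltnNge ltnW.
rewrite eqE Fd andbF /=; case: eqP => //= cd'.
by move: cd; rewrite cd' ltnn.
Qed.

(** * Interlaced eyes *)

Definition twice_at (c : nat) (s : seq nat) (i j : nat) : Prop :=
  [/\ i < j, j < size s
    & forall k, k < size s -> (nth 0 s k == c) = (k == i) || (k == j)].

Lemma mem_occurrences c s k :
  (k \in occurrences c s) = (k < size s) && (nth 0 s k == c).
Proof. by rewrite mem_filter mem_iota andbC. Qed.

Lemma size_occurrences c s : size (occurrences c s) = count_mem c s.
Proof.
by rewrite size_filter -[in RHS](mkseq_nth 0 s) /mkseq count_map.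
Qed.

Lemma occurrences_sorted c s : sorted ltn (occurrences c s).
Proof. exact: sorted_filter ltn_trans _ _ (iota_ltn_sorted _ _). Qed.

Lemma occurrences_absent c s : c \notin s -> occurrences c s = [::].
Proof.
by move=> h; apply/eqP; rewrite -size_eq0 size_occurrences (count_memPn h).
Qed.

Lemma occurrences_twice c s i j : twice_at c s i j -> occurrences c s = [:: i; j].
Proof.
case=> ij js h; apply: (irr_sorted_eq ltn_trans ltnn (occurrences_sorted _ _)).
  by rewrite /= ij.
move=> k; rewrite mem_occurrences !inE; case: ltnP => ks /=; first exact: h.
by apply/esym/norP; split; lia.
Qed.

Lemma paired_twice new s c :
  paired new s -> c \in s -> exists i j, twice_at c s i j.
Proof.
move=> ps cs; have [_] := ps c cs; rewrite -size_occurrences.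
have := occurrences_sorted c s; have := mem_occurrences c s.
case: (occurrences c s) => [|i [|j []]] //= h; rewrite andbT => ij _.
exists i, j; split=> //.
  by have := h j; rewrite !inE eqxx orbT => /esym/andP[].
by move=> k ks; have := h k; rewrite !inE ks => ->.
Qed.

Definition bottom (c : nat) (s : seq nat) : nat := head 0 (occurrences c s).
Definition top (c : nat) (s : seq nat) : nat := last 0 (occurrences c s).

Lemma twice_ends c s i j : twice_at c s i j -> (bottom c s = i) * (top c s = j).
Proof. by move=> /occurrences_twice E; rewrite /bottom /top E. Qed.

Lemma absent_ends c s : c \notin s -> (bottom c s = 0) * (top c s = 0).
Proof. by move=> /occurrences_absent E; rewrite /bottom /top E. Qed.

Definition interlaced (c d : nat) (s : seq nat) : bool :=
  [&& top c s > top d s, top d s > bottom c s & bottom c s > bottom d s]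
  || [&& top d s > top c s, top c s > bottom d s & bottom d s > bottom c s].

Lemma interlaced_absent c d s :
  (c \notin s) || (d \notin s) -> interlaced c d s = false.
Proof.
by case/orP=> /absent_ends E; rewrite /interlaced !E ?andbF //= !ltn0 ?andbF.
Qed.

Lemma interlaced_adjacent c d s i : twice_at c s i i.+1 -> interlaced c d s = false.
Proof. by move=> /twice_ends E; rewrite /interlaced !E; lia. Qed.

Lemma interlacedC c d s : interlaced c d s = interlaced d c s.
Proof. by rewrite /interlaced orbC. Qed.

Lemma twice_at_step n e sw new s c i j i' j' :
  event_ok n e sw s -> c != new -> twice_at c s i j ->
  through e sw i = Some i' -> through e sw j = Some j' -> i' < j' ->
  twice_at c (step e sw new s) i' j'.
Proof.
move=> h cn [ij js hc] ti tj ij'.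
have is_ : i < size s by lia.
have [_ ei] := through_step new h is_ ti.
have [j's ej] := through_step new h js tj.
split=> // k ks; case: (through_onto h ks) => [[l ls tl]|[lc hk ->]].
  have [_ ->] := through_step new h ls tl; rewrite hc //.
  move: tl ti tj; rewrite /through; case: (kind e) (event_ok_pos h) => /= hp.
  - case=> <- [<-] [<-].
    by case: (ltnP l (pos e)) (ltnP i (pos e)) (ltnP j (pos e)) => ? [] ? [] ?; lia.
  - case: (ltnP l (pos e)) (ltnP l (pos e).+2) (ltnP i (pos e))
      (ltnP i (pos e).+2) (ltnP j (pos e)) (ltnP j (pos e).+2)
      => ? [] ? [] ? [] ? [] ? [] ? //; case=> <- [<-] [<-]; lia.
  case=> <- [<-] [<-]; case: (sw) => //.
  by case: (l =P pos e) (l =P (pos e).+1) (i =P pos e) (i =P (pos e).+1)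
      (j =P pos e) (j =P (pos e).+1) => ? [] ? [] ? [] ? [] ? [] ?; lia.
rewrite eq_sym (negbTE cn); apply/esym/norP.
move: lc ti tj; rewrite /is_lcusp /through; case: (kind e) => //= _ [<-] [<-].
by case: (ltnP i (pos e)) (ltnP j (pos e)) => ? [] ?; case: hk => ->; split; lia.
Qed.

Lemma absent_step n e sw new s x : event_ok n e sw s -> x != new ->
  x \notin s -> x \notin step e sw new s.
Proof.
move=> h xn; apply: contra => /(nthP 0)[l hl E]; move: E.
case: (through_onto h hl) => [[k ks /(through_step new h ks)[_ ->]] <-|].
  exact: mem_nth.
by case=> _ _ -> E; rewrite E eqxx in xn.
Qed.

Lemma twice_at_new n e sw new s : event_ok n e sw s -> is_lcusp e ->
  new \notin s -> twice_at new (step e sw new s) (pos e) (pos e).+1.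
Proof.
move=> h lc ns; have := event_ok_pos h; move: lc (size_step new h).
rewrite /is_lcusp; case E: (kind e) => //= _; rewrite subn0 addn0 => sz hp.
split=> //; first lia.
move=> k ks; rewrite nth_lcusp_step //.
have other i : i < size s -> (nth 0 s i == new) = false.
  by move=> hi; apply: contraNF ns => /eqP <-; apply: mem_nth.
case: (ltnP k (pos e)) => ?; first by rewrite other; lia.
case: (ltnP k (pos e).+2) => ?; first by rewrite eqxx; lia.
by rewrite other; lia.
Qed.

Lemma twice_disjoint c d s i j i' j' : c != d ->
  twice_at c s i j -> twice_at d s i' j' ->
  [/\ i != i', i != j', j != i' & j != j'].
Proof.
move=> cd [ij js hc] [ij' js' hd].
have both k : k < size s -> (nth 0 s k == c) -> (nth 0 s k == d) = false.
  by move=> _ /eqP ->; apply: negbTE.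
have := both i; rewrite hc ?hd; [|lia..].
have := both j; rewrite hc ?hd; [|lia..].
by rewrite !eqxx orbT => /(_ js isT) ? /(_ (ltn_trans ij js) isT) ?; split; lia.
Qed.

Lemma insert_lt p x y :
  ((if x < p then x else x.+2) < (if y < p then y else y.+2)) = (x < y).
Proof. by case: (ltnP x p) (ltnP y p) => ? [] ?; lia. Qed.

Lemma delete_lt p x y : x != p -> x != p.+1 -> y != p -> y != p.+1 ->
  ((if x < p then x else x - 2) < (if y < p then y else y - 2)) = (x < y).
Proof. by case: (ltnP x p) (ltnP y p) => ? [] ?; lia. Qed.

Definition swap_pos (p x : nat) : nat :=
  if x == p then x.+1 else if x == p.+1 then x.-1 else x.

Lemma swap_posE p :
  (swap_pos p p = p.+1) * (swap_pos p p.+1 = p) *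
  (forall x, x != p -> x != p.+1 -> swap_pos p x = x).
Proof.
split; first split; rewrite /swap_pos ?eqxx //; first by rewrite ifN ?eqxx //; lia.
by move=> x /negbTE -> /negbTE ->.
Qed.

Lemma swap_pos_lt p x y :
  ~~ ((x == p) && (y == p.+1) || (x == p.+1) && (y == p)) ->
  (swap_pos p x < swap_pos p y) = (x < y).
Proof.
case: (x =P p) => [->|/eqP x1]; [|case: (x =P p.+1) => [->|/eqP x2]];
(case: (y =P p) => [->|/eqP y1]; [|case: (y =P p.+1) => [->|/eqP y2]]);
  rewrite ?swap_posE //=; lia.
Qed.

Definition interlaced_pos (i j i' j' : nat) : bool :=
  [&& j > j', j' > i & i > i'] || [&& j' > j, j > i' & i' > i].

Lemma interlaced_posC i j i' j' :
  interlaced_pos i j i' j' = interlaced_pos i' j' i j.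
Proof. by rewrite /interlaced_pos orbC. Qed.

Lemma interlaced_swap p i j i' j' : i < j -> i' < j' ->
    [/\ i != i', i != j', j != i' & j != j'] ->
    ((p == i) || (p == j)) && ((p.+1 == i') || (p.+1 == j')) ->
  interlaced_pos (swap_pos p i) (swap_pos p j) (swap_pos p i') (swap_pos p j')
  = ~~ interlaced_pos i j i' j'.
Proof.
move=> ij ij' [? ? ? ?] /andP[/orP[]/eqP ? /orP[]/eqP ?]; subst;
  rewrite /interlaced_pos !swap_posE //; lia.
Qed.

Lemma through_cusp e sw k : ~~ is_crossing e ->
  through e sw k =
  if is_lcusp e then Some (if k < pos e then k else k.+2)
  else if k < pos e then Some k
  else if k < (pos e).+2 then None else Some (k - 2).
Proof. by rewrite /is_crossing /through /is_lcusp; case: (kind e). Qed.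

(** A cusp of either eye has its two strands next to each other, so that the eyes
    are not interlaced near it; any other cusp only shifts heights. *)
Lemma interlaced_cusp e sw new s c d : event_ok false e sw s -> paired new s ->
  c != d -> ~~ is_crossing e -> 
  interlaced c d (step e sw new s) = interlaced c d s.
Proof.
move=> h ps cd ncr; have nn := paired_new ps.
wlog cn : c d cd / c != new.
  move=> IH; case: (eqVneq c new) => [cn|]; last exact: IH.
  by rewrite ![interlaced c d _]interlacedC IH // -?cn 1?eq_sym.
case cs: (c \in s); last first.
  by rewrite !interlaced_absent ?cs // (absent_step h) ?cs.
case ds: (d \in s); last first.
  rewrite [RHS]interlaced_absent ?ds ?orbT //.
  case: (eqVneq d new) => [dn|dn]; last first.
    by rewrite interlaced_absent // (absent_step h dn) ?ds ?orbT.
  case lc: (is_lcusp e).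
    by rewrite interlacedC dn (interlaced_adjacent _ (twice_at_new h lc _)).
  rewrite interlaced_absent // orbC dn; apply/orP; left.
  apply/negP=> /(nthP 0)[l hl E]; case: (through_onto h hl); last first.
    by case; rewrite lc.
  case=> k hk /(through_step new h hk)[_]; rewrite E => E'.
  by move: nn; rewrite E' mem_nth.
have dn : d != new by apply: contraNneq nn => <-.
have [i [j tc]] := paired_twice ps cs; have [i' [j' td]] := paired_twice ps ds.
have [n1 n2 n3 n4] := twice_disjoint cd tc td.
have [ij js hc] := tc; have [ij' js' hd] := td.
case lc: (is_lcusp e).
  have img x u v : x != new -> twice_at x s u v ->
    twice_at x (step e sw new s) (if u < pos e then u else u.+2)
                                 (if v < pos e then v else v.+2).
    move=> xn tx; have [uv vs _] := tx.
    apply: (twice_at_step h xn tx); rewrite ?through_cusp ?lc //.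
    by rewrite insert_lt.
  rewrite /interlaced !(twice_ends (img _ _ _ cn tc), twice_ends (img _ _ _ dn td)).
  by rewrite !insert_lt !(twice_ends tc, twice_ends td).
have [hp eqp] : (pos e).+1 < size s /\ nth 0 s (pos e) == nth 0 s (pos e).+1.
  move: h ncr lc; rewrite /event_ok /is_crossing /is_lcusp.
  by case: (kind e) => //= /and3P[h1 _ h2] _ _; split=> //; rewrite -addn2.
have dies x y u v : twice_at x s u v -> x != new -> u = pos e ->
    interlaced x y (step e sw new s) = interlaced x y s.
  move=> tx xn up; have [uv vs hx] := tx.
  have vp : v = u.+1.
    by have := hx (pos e).+1 hp; rewrite -(eqP eqp) hx; lia.
  rewrite [RHS](@interlaced_adjacent _ _ _ u) -?vp //.
  rewrite interlaced_absent //; apply/orP; left.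
  apply/negP=> /(nthP 0)[l hl E]; case: (through_onto h hl); last first.
    by case; rewrite lc.
  case=> k hk thr; have [_] := through_step new h hk thr.
  rewrite E => /esym/eqP; rewrite hx // => hk'; move: thr.
  rewrite through_cusp // lc; case: (ltnP k (pos e)) => [|_]; first lia.
  by case: ltnP => //; lia.
case: (i =P pos e) => [ip|ip]; first exact: dies tc cn ip.
case: (i' =P pos e) => [ip'|ip'].
  by rewrite ![interlaced c d _]interlacedC; apply: dies td dn ip'.
have off x u v : twice_at x s u v -> u != pos e ->
    [/\ u != (pos e).+1, v != pos e & v != (pos e).+1].
  move=> [uv vs hx] up; have := hx (pos e).+1 hp.
  by rewrite -(eqP eqp) hx; [split; lia | lia].
have [o1 o2 o3] := off _ _ _ tc (introN eqP ip).
have [o4 o5 o6] := off _ _ _ td (introN eqP ip').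
have img x u v : x != new -> twice_at x s u v ->
    [/\ u != pos e, u != (pos e).+1, v != pos e & v != (pos e).+1] ->
  twice_at x (step e sw new s) (if u < pos e then u else u - 2)
                               (if v < pos e then v else v - 2).
  move=> xn tx [? ? ? ?]; have [uv vs _] := tx.
  apply: (twice_at_step h xn tx); rewrite ?through_cusp ?lc //.
  - by case: (ltnP u (pos e)) => // ?; rewrite ifN //; lia.
  - by case: (ltnP v (pos e)) => // ?; rewrite ifN //; lia.
  by rewrite delete_lt.
rewrite /interlaced.
rewrite !(twice_ends (img _ _ _ cn tc _), twice_ends (img _ _ _ dn td _)) //;
  try by split=> //; apply/eqP.
move/eqP in ip; move/eqP in ip'.
by rewrite !(twice_ends tc, twice_ends td) !delete_lt.
Qed.

Definition crosses (e : event) (sw : bool) (s : seq nat) (c d : nat) : bool :=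
  let a := nth 0 s (pos e) in let b := nth 0 s (pos e).+1 in
  [&& is_crossing e, ~~ sw & (a == c) && (b == d) || (a == d) && (b == c)].

Lemma interlaced_crossing p new s c d : event_ok false ('X_p) false s ->
    paired new s -> c != d ->
  interlaced c d (step ('X_p) false new s)
  = interlaced c d s (+) crosses ('X_p) false s c d.
Proof.
move=> h ps cd; rewrite /crosses /=; have nn := paired_new ps.
have [hp ab] : p.+1 < size s /\ nth 0 s p != nth 0 s p.+1.
  by move: h; rewrite /event_ok andbT /= addn2 => /andP.
have [/andP[cs ds]|] := boolP ((c \in s) && (d \in s)); last first.
  rewrite negb_and => cds.
  have out x : x \notin s -> x \notin step ('X_p) false new s.
    apply: contra => /(nthP 0)[l hl <-]; case: (through_onto h hl) => [|[] //].
    by case=> k hk /(through_step new h hk)[_ ->]; apply: mem_nth.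
  rewrite !interlaced_absent //; last by case/orP: cds => /out ->; rewrite ?orbT.
  apply/esym/negP => /orP[] /andP[/eqP ac /eqP bd];
  by move: cds; rewrite -ac -bd !mem_nth // ltnW.
have cn : c != new by apply: contraNneq nn => <-.
have dn : d != new by apply: contraNneq nn => <-.
have [i [j tc]] := paired_twice ps cs; have [i' [j' td]] := paired_twice ps ds.
have n := twice_disjoint cd tc td.
have img x u v : x != new -> twice_at x s u v ->
    twice_at x (step ('X_p) false new s) (swap_pos p u) (swap_pos p v).
  move=> xn tx; have [uv vs hx] := tx.
  apply: (twice_at_step h xn tx); rewrite // swap_pos_lt //.
  apply/negP => /orP[] /andP[/eqP up /eqP vp]; last by move: uv; rewrite up vp; lia.
  move: (hx p) (hx p.+1); rewrite up vp !eqxx orbT.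
  by move=> /(_ (ltnW hp))/eqP E /(_ hp)/eqP E'; rewrite E E' eqxx in ab.
have [ij js hc] := tc; have [ij' js' hd] := td.
rewrite (hc _ hp) (hd _ hp) (hc _ (ltnW hp)) (hd _ (ltnW hp)).
rewrite /interlaced !(twice_ends (img _ _ _ cn tc), twice_ends (img _ _ _ dn td)).
rewrite !(twice_ends tc, twice_ends td) -/(interlaced_pos i j i' j').
rewrite -/(interlaced_pos (swap_pos p i) (swap_pos p j)
                          (swap_pos p i') (swap_pos p j')).
case: (boolP (((p == i) || (p == j)) && _)) => [|np].
  by move/interlaced_swap=> -> //; rewrite addbT.
case: (boolP (((p == i') || (p == j')) && _)) => [|np'].
  rewrite [LHS]interlaced_posC [interlaced_pos i _ _ _]interlaced_posC.
  move/interlaced_swap=> -> //.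
    by rewrite addbT.
  by case: n => *; split; rewrite eq_sym.
rewrite addbF /interlaced_pos; clear - np np'.
by rewrite !swap_pos_lt //; lia.
Qed.

(** Two eyes become interlaced, or stop being so, exactly where they cross.  This
    makes every crossing an end of one maximal interval. *)
Lemma interlaced_step e sw new s c d : event_ok false e sw s -> paired new s ->
  c != d ->
  interlaced c d s (+) interlaced c d (step e sw new s) = crosses e sw s c d.
Proof.
move=> h ps cd; case ncr: (is_crossing e); last first.
  by rewrite /crosses (interlaced_cusp h ps cd) ?ncr // addbb.
case: e h ncr => -[] // p h _.
case: sw h => h; first by rewrite /crosses /step /= addbb.
by rewrite (interlaced_crossing h ps cd) addbA addbb.
Qed.

(** * Clasps and weights *)

Section TwicePrefix.
Variables (c : nat) (s : seq nat) (i j q : nat).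
Hypotheses (tc : twice_at c s i j) (qs : q <= size s).

Lemma twice_take : (c \in take q s) = (i < q).
Proof.
have [ij js hc] := tc; apply/idP/idP => [/(nthP 0)[k]|lt].
  rewrite size_takel // => kq; rewrite nth_take // => /eqP.
  by rewrite hc; lia.
have /eqP <- : nth 0 s i == c by rewrite hc ?eqxx //; lia.
by rewrite -(nth_take 0 lt) mem_nth // size_takel.
Qed.

Lemma index_twice_take : i < q <= j -> index c (take q s) = i.
Proof.
case/andP=> lt qj; have [ij js hc] := tc.
have ct : c \in take q s by rewrite twice_take.
have lt' : index c (take q s) < q by rewrite -[q in _ < q](size_takel qs) index_mem.
have /eqP := nth_index 0 ct; rewrite nth_take //.
by move: (index c _) lt' => k lt'; rewrite hc; lia.
Qed.

Lemma index_twice_drop : i < q <= j -> index c (drop q s) = j - q.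
Proof.
case/andP=> lt qj; have [ij js hc] := tc.
have ct : c \in drop q s.
  have /eqP <- : nth 0 s j == c by rewrite hc ?eqxx ?orbT.
  rewrite -[j in nth _ _ j](subnKC qj) -nth_drop mem_nth //.
  by rewrite size_drop ltn_sub2r // (leq_ltn_trans qj).
have lt' : index c (drop q s) < size s - q by rewrite -size_drop index_mem.
have /eqP := nth_index 0 ct; rewrite nth_drop.
by move: (index c _) lt' => k lt'; rewrite hc; lia.
Qed.

End TwicePrefix.

Lemma card_two_pairs (T : finType) (x y z t : T) : x != y -> z != t ->
  (#|[set x; y; z; t]| == 2) = all (mem [:: x; y]) [:: z; t].
Proof.
move=> xy zt; have two : #|[set x; y]| = 2 by rewrite cards2 xy.
have sub : [set x; y] \subset [set x; y; z; t].
  by apply/subsetP=> w; rewrite !inE => /orP[] ->; rewrite ?orbT.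
have -> : (#|[set x; y; z; t]| == 2) = ([set x; y; z; t] \subset [set x; y]).
  apply/eqP/idP => [E|sub2].
    by have /eqP<- : [set x; y] == [set x; y; z; t] by rewrite eqEcard sub E two.
  rewrite -two; apply: eq_card => w.
  by apply/idP/idP; [apply: (subsetP sub2) | apply: (subsetP sub)].
by rewrite !subUset !sub1set !inE !eqxx ?orbT /= !inE !andbT.
Qed.

Lemma middle_crossing p j j' l l' : j < j' -> l < l' ->
    [/\ j != l, j != l', j' != l & j' != l'] ->
    (p == j) || (p == j') -> (p.+1 == l) || (p.+1 == l') ->
  ((j < p) == (l < p)) = ~~ [|| (p == j) && (p.+1 == l'),
      (p == j') && (p.+1 == l), (p == l) && (p.+1 == j')
    | (p == l') && (p.+1 == j)].
Proof.
move=> jj' ll' [? ? ? ?] /orP[]/eqP ? /orP[]/eqP ?; subst; lia.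
Qed.

Section Rulings.
Variables (D : diagram) (rho : bitseq).
Hypothesis ok : run_ok false D rho 0 [::].
Let st := state D rho.

Section Pair.
Variables (i0 k0 i1 k1 : nat).
Hypotheses (h0 : on_slice D rho i0 k0) (h1 : on_slice D rho i1 k1).
Let E := component_at D rho i0 k0.
Let F := component_at D rho i1 k1.
Let c := label D rho i0 k0.
Let d := label D rho i1 k1.

Lemma lowerE i : i <= size D -> lower E i = bottom c (st i).
Proof. by move=> hi; rewrite /lower (heights_occurrences ok h0 hi). Qed.

Lemma upperE i : i <= size D -> upper E i = top c (st i).
Proof. by move=> hi; rewrite /upper (heights_occurrences ok h0 hi). Qed.

End Pair.

Lemma non_nestedE i0 k0 i1 k1 i :
    on_slice D rho i0 k0 -> on_slice D rho i1 k1 -> i <= size D ->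
  non_nested (component_at D rho i0 k0) (component_at D rho i1 k1) i
  = interlaced (label D rho i0 k0) (label D rho i1 k1) (st i).
Proof. by move=> h0 h1 hi; rewrite /non_nested !lowerE // !upperE. Qed.

Lemma crossing_slice i : i < size D -> is_crossing (ev D i) ->
  [/\ on_slice D rho i (pos (ev D i)), on_slice D rho i (pos (ev D i)).+1
    & label D rho i (pos (ev D i)) != label D rho i (pos (ev D i)).+1].
Proof.
move=> hi; have := ok_state ok hi; rewrite /event_ok /is_crossing /on_slice.
rewrite (ltnW hi); case: (kind _) => //= /and3P[hp ne _] _; split=> //; lia.
Qed.

(** A strand is the upper one of its eye when the eye has a strand below it. *)
Lemma crossing_weight_type i0 k0 i1 k1 i :
    on_slice D rho i0 k0 -> on_slice D rho i1 k1 -> i < size D ->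
    is_crossing (ev D i) ->
    label D rho i (pos (ev D i)) = label D rho i0 k0 ->
    label D rho i (pos (ev D i)).+1 = label D rho i1 k1 ->
  crossing_weight (take (pos (ev D i)) (st i))
    (label D rho i0 k0) (label D rho i1 k1)
  = 1 + 2 * type_M (component_at D rho i0 k0) (component_at D rho i1 k1) i.
Proof.
move=> h0 h1 hi cr; rewrite /type_M !lowerE ?upperE //; try exact: ltnW.
have [hp hp1 ne] := crossing_slice hi cr; move: hp hp1 ne.
rewrite /on_slice (ltnW hi) /= => hp hp1; rewrite {1 2}/label -/st => ne E0 E1.
have ps := paired_state ok (ltnW hi).
have c_in : label D rho i0 k0 \in st i by rewrite -E0 mem_nth.
have d_in : label D rho i1 k1 \in st i by rewrite -E1 mem_nth.
have [j [j' tc]] := paired_twice ps c_in; have [l [l' td]] := paired_twice ps d_in.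
rewrite !(twice_ends tc, twice_ends td).
have cd : label D rho i0 k0 != label D rho i1 k1 by rewrite -E0 -E1.
have [n1 n2 n3 n4] := twice_disjoint cd tc td.
have [jj' j's hc] := tc; have [ll' l's hd] := td.
move: E0 E1; rewrite {1}/label {2}/label -/st => E0 E1.
have := hc _ hp; rewrite E0 eqxx => /esym pj.
have := hd _ hp1; rewrite E1 eqxx => /esym pl.
rewrite /crossing_weight (twice_take tc (ltnW hp)) (twice_take td (ltnW hp)).
rewrite (middle_crossing jj' ll' _ pj pl) //.
by case: ifP => [/negbTE->|/negbFE->].
Qed.

Lemma type_MC (E F : {set point D}) i : type_M E F i = type_M F E i.
Proof. by rewrite /type_M orbA [RHS]orbA orbC; congr (_ || _); rewrite orbC. Qed.

Definition upper_of (i : nat) := component_at D rho i (pos (ev D i)).+1.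
Definition lower_of (i : nat) := component_at D rho i (pos (ev D i)).

Lemma pair_weight (E F : {set point D}) (i : nat) :
    E \in components D rho -> F \in components D rho -> E != F -> i < size D ->
  (non_nested E F i (+) non_nested E F i.+1) * (1 + 2 * type_M E F i)
  = ((E == lower_of i) && (F == upper_of i)
     || (E == upper_of i) && (F == lower_of i))
    * event_weight (ev D i) (switch rho i) (st i).
Proof.
move=> /(components_at ok)[i0 [k0 [h0 ->]]] /(components_at ok)[i1 [k1 [h1 ->]]].
rewrite component_atE // => cd hi.
rewrite !(non_nestedE h0 h1) ?(ltnW hi) // {2}/st (stateS ok hi).
rewrite (interlaced_step (ok_state ok hi) (paired_state ok (ltnW hi)) cd).
rewrite /crosses /event_weight.
rewrite -[nth 0 (state D rho i) (pos _)]/(label D rho i (pos (ev D i))).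
rewrite -[nth 0 (state D rho i) (pos _).+1]/(label D rho i (pos (ev D i)).+1).
case cr: (is_crossing (ev D i)); last by rewrite muln0.
case: (switch rho i); rewrite /= ?muln0 //.
have [s0 s1 _] := crossing_slice hi cr.
rewrite /lower_of /upper_of !component_atE //.
rewrite ![label D rho i0 k0 == _]eq_sym ![label D rho i1 k1 == _]eq_sym.
case: andP => [[/eqP E0 /eqP E1]|_].
  by rewrite E0 E1 -(crossing_weight_type h0 h1).
rewrite /= andbC; case: andP => [[/eqP E0 /eqP E1]|_] //.
by rewrite E0 E1 type_MC -(crossing_weight_type h1 h0).
Qed.

Lemma weight_sum : weight D rho 0 [::]
  = \sum_(i < size D) event_weight (ev D i) (switch rho i) (st i).
Proof.
have E n : n <= size D -> weight (take n D) (take n rho) 0 [::]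
    = \sum_(i < n) event_weight (ev D i) (switch rho i) (st i).
  elim: n => [|n IH] hn; first by rewrite !take0 big_ord0.
  have sr := run_ok_size ok.
  rewrite big_ord_recr -IH 1?ltnW // (take_nth ('X_0)) // (take_nth false) ?sr //.
  rewrite -!cats1 weight_cat; last by rewrite !size_takel ?sr // ltnW.
  by rewrite /= addn0.
by rewrite -E // take_size -(run_ok_size ok) take_size.
Qed.

Hypothesis front : is_front D.

Lemma state_end : st (size D) = [::].
Proof.
have := is_front_from_run [::] ok; rewrite cats0 -/(is_front D) front.
rewrite /st /state take_size -(run_ok_size ok) take_size /=.
by move/esym/eqP/size0nil.
Qed.

Lemma clasps_between_weight (E F : {set point D}) :
    E \in components D rho -> F \in components D rho -> E != F ->
  2 * clasps_between E F
  = \sum_(i < size D) ((E == lower_of i) && (F == upper_of i)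
      || (E == upper_of i) && (F == lower_of i))
      * event_weight (ev D i) (switch rho i) (st i) %[mod 4].
Proof.
move=> hE hF EF.
have [n0 nN] : ~~ non_nested E F 0 /\ ~~ non_nested E F (size D).
  move: hE hF => /(components_at ok)[i0 [k0 [h0 ->]]].
  move=> /(components_at ok)[i1 [k1 [h1 ->]]].
  rewrite !(non_nestedE h0 h1) // state_end /st /state !take0.
  by rewrite !interlaced_absent.
rewrite (clasps_mod4 n0 nN (type_M E F)); congr (_ %% 4).
by apply: eq_bigr => i _; apply: pair_weight.
Qed.

(** Between two eyes, the clasps are counted modulo 4 by their crossings
    ([clasps_between_weight]), and every crossing that is not a switch is between
    exactly one pair of eyes. *)
Theorem clasps_weight : 2 * clasps D rho = weight D rho 0 [::] %[mod 4].
Proof.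
rewrite weight_sum.
transitivity ((\sum_(E in components D rho)
   \sum_(F in components D rho | enum_rank E < enum_rank F)
   \sum_(i < size D) ((E == lower_of i) && (F == upper_of i)
      || (E == upper_of i) && (F == lower_of i))
      * event_weight (ev D i) (switch rho i) (st i)) %% 4).
  rewrite /clasps big_distrr /=.
  have add a b c d : a = b %[mod 4] -> c = d %[mod 4] -> a + c = b + d %[mod 4].
    by move=> h h'; rewrite -modnDm h h' modnDm.
  elim/big_ind2: _ => // [*|E hE]; first exact: add.
  rewrite big_distrr /=.
  elim/big_ind2: _ => // [*|F /andP[hF EF]]; first exact: add.
  apply: clasps_between_weight => //.
  by apply: contraTneq EF => ->; rewrite ltnn.
congr (_ %% 4).
rewrite (eq_bigr (fun E => \sum_(i < size D)
   \sum_(F in components D rho | enum_rank E < enum_rank F)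
    ((E == lower_of i) && (F == upper_of i)
      || (E == upper_of i) && (F == lower_of i))
      * event_weight (ev D i) (switch rho i) (st i))); last first.
  by move=> E _; rewrite exchange_big.
rewrite exchange_big /=; apply: eq_bigr => i _.
under eq_bigr do rewrite -big_distrl.
rewrite -big_distrl /=; case cr: (is_crossing (ev D i)); last first.
  by rewrite /event_weight cr muln0.
have [s0 s1 ne] := crossing_slice (ltn_ord i) cr.
rewrite sum_pairs ?mul1n //.
- by apply/(components_at ok); exists i, (pos (ev D i)).
- by apply/(components_at ok); exists i, (pos (ev D i)).+1.
by rewrite component_atE.
Qed.

End Rulings.

(** * Switches in terms of labels *)

Lemma interchangesE D rho i : run_ok false D rho 0 [::] -> i.+1 < size D ->
    is_crossing (ev D i) -> is_crossing (ev D i.+1) ->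
  interchanges_switches D rho i = (switch rho i (+) switch rho i.+1) &&
    all (mem [:: label D rho i (pos (ev D i)); label D rho i (pos (ev D i)).+1])
      [:: label D rho i.+1 (pos (ev D i.+1));
          label D rho i.+1 (pos (ev D i.+1)).+1].
Proof.
move=> ok hi cr cr'; rewrite /interchanges_switches cr cr' /=; congr (_ && _).
have [s0 s1 ne] := crossing_slice ok (ltnW hi) cr.
have [s2 s3 ne'] := crossing_slice ok hi cr'.
rewrite card_two_pairs ?component_atE //= !inE !andbT !component_atE //.
Qed.

Lemma run_ok_normal D rho : run_ok false D rho 0 [::] ->
    (forall i, i < size D ->
       event_ok true (ev D i) (switch rho i) (state D rho i)) ->
  run_ok true D rho 0 [::].
Proof.
move=> ok h; have sr := run_ok_size ok.
have E n : n <= size D -> run_ok true (take n D) (take n rho) 0 [::].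
  elim: n => [|n IH] hn; first by rewrite !take0.
  rewrite (take_nth ('X_0)) // (take_nth false) ?sr //.
  rewrite -!cats1 run_ok_cat; last by rewrite !size_takel ?sr // ltnW.
  by rewrite IH 1?ltnW //= h.
by have := E (size D) (leqnn _); rewrite -{2}sr !take_size.
Qed.

Lemma nested_pos p j j' l l' : j < j' -> l < l' ->
    [/\ j != l, j != l', j' != l & j' != l'] ->
    (p == j) || (p == j') -> (p.+1 == l) || (p.+1 == l') ->
    [|| (j' < l) || (l' < j), (l < j) && (j' < l') | (j < l) && (l' < j')] ->
  if j < p then (l < p) ==> (l < j) else (p <= l) && (l' < j').
Proof.
move=> jj' ll' [? ? ? ?] /orP[]/eqP ? /orP[]/eqP ? h; subst; case: ifP; lia.
Qed.

Lemma normal_ruling_run_ok D rho :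
  run_ok false D rho 0 [::] -> normal_ruling D rho -> run_ok true D rho 0 [::].
Proof.
move=> ok /and4P[_ _ _ /forallP nrm]; apply: run_ok_normal => // i hi.
have oki := ok_state ok hi; move: (oki); rewrite /event_ok.
have := nrm (Ordinal hi); rewrite /=; case: (switch rho i) => /=; last first.
  by case: (kind _).
case K: (kind _) => // nrmi /and3P[hp ne _]; rewrite hp ne /=.
have cr : is_crossing (ev D i) by rewrite /is_crossing K.
have [s0 s1 _] := crossing_slice ok hi cr.
have ps := paired_state ok (ltnW hi).
rewrite addn2 in hp.
have [j [j' tc]] := paired_twice ps (mem_nth 0 (ltnW hp)).
have [l [l' td]] := paired_twice ps (mem_nth 0 hp).
have [jj' j's hc] := tc; have [ll' l's hd] := td.
have := hc _ (ltnW hp); rewrite eqxx => /esym pj.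
have := hd _ hp; rewrite eqxx => /esym pl.
have dj := twice_disjoint ne tc td; have [? ? ? ?] := dj.
move: nrmi; rewrite /normal_at /disjoint_at /inside_at.
rewrite !(lowerE ok _ (ltnW hi)) // !(upperE ok _ (ltnW hi)) //.
rewrite /label !(twice_ends tc, twice_ends td) => /(nested_pos jj' ll' dj pj pl).
rewrite /nested_at (twice_take tc (ltnW (ltnW hp))) (twice_take td (ltnW (ltnW hp))).
case: ifP => jp.
  case: (ltnP l _) => // lp /=.
  rewrite (index_twice_take tc) ?(index_twice_take td) //; lia.
case/andP=> lp lj; rewrite -leqNgt lp /=.
rewrite (index_twice_drop tc) ?(index_twice_drop td) //; lia.
Qed.

(** * The moves preserve the invariant *)

(** [interchanges_switches] read off the labels of the slice before the strip. *)
Definition local_interchange (w : diagram) (p q : bool) (new : nat)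
    (s : seq nat) : bool :=
  if w is [:: e; e'] then
    let s' := step e p new s in
    [&& is_crossing e, is_crossing e', p (+) q
      & all (mem [:: nth 0 s (pos e); nth 0 s (pos e).+1])
            [:: nth 0 s' (pos e'); nth 0 s' (pos e').+1]]
  else false.

Arguments local_interchange : simpl never.

Lemma interchanges_local A w B a p q b : size a = size A -> size w = 2 ->
    run_ok false (A ++ w ++ B) (a ++ [:: p; q] ++ b) 0 [::] ->
  interchanges_switches (A ++ w ++ B) (a ++ [:: p; q] ++ b) (size A)
  = local_interchange w p q (size A) (run A a 0 [::]).
Proof.
case: w => [|e [|e' []]] // sa _; set D := A ++ _; set rho := a ++ _ => ok.
have ev0 : ev D (size A) = e by rewrite /ev /D nth_cat ltnn subnn.
have ev1 : ev D (size A).+1 = e' by rewrite /ev /D nth_cat ltnNge leqnSn subSnn.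
have sw0 : switch rho (size A) = p by rewrite /switch /rho nth_cat sa ltnn subnn.
have sw1 : switch rho (size A).+1 = q.
  by rewrite /switch /rho nth_cat sa ltnNge leqnSn subSnn.
have szD : (size A).+1 < size D by rewrite /D size_cat /=; lia.
have st0 : state D rho (size A) = run A a 0 [::].
  by rewrite /state take_size_cat // take_size_cat.
rewrite /local_interchange.
case cr: (is_crossing e); last by rewrite /interchanges_switches ev0 cr.
case cr': (is_crossing e'); last by rewrite /interchanges_switches ev1 cr' andbF.
rewrite interchangesE ?ev0 ?ev1 // sw0 sw1 /label st0.
by rewrite (stateS ok (ltnW szD)) ev0 sw0 st0.
Qed.

Lemma split_exchange (s : seq nat) j k p q :
  j + p <= k -> k + q <= size s -> exists u x m y v,
   [/\ s = u ++ x ++ m ++ y ++ v, size u = j, size x = p,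
       size (u ++ x ++ m) = k & size y = q].
Proof.
move=> jk ks; exists (take j s), (take p (drop j s)).
exists (take (k - (j + p)) (drop (j + p) s)), (take q (drop k s)), (drop (k + q) s).
have sx : size (take p (drop j s)) = p by rewrite size_takel // size_drop; lia.
have sm : size (take (k - (j + p)) (drop (j + p) s)) = k - (j + p).
  by rewrite size_takel // size_drop; lia.
split; rewrite ?size_cat ?sx ?sm ?size_takel ?size_drop //; try lia.
have E a b : a <= b -> take (b - a) (drop a s) ++ drop b s = drop a s.
  by move=> ab; rewrite -{2}(subnK ab) -drop_drop cat_take_drop.
have := E k (k + q) (leq_addr _ _); rewrite addKn => ->.
rewrite (E (j + p) k) //.
have := E j (j + p) (leq_addr _ _); rewrite addKn => ->.
by rewrite cat_take_drop.
Qed.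

Lemma all_mem_pair (c d e f : nat) : c != d -> e != f ->
  all (mem [:: c; d]) [:: e; f] = all (mem [:: e; f]) [:: c; d].
Proof.
move=> cd ef; rewrite /= !inE !andbT; apply/andP/andP.
  by case=> /orP[]/eqP ? /orP[]/eqP ?; subst; rewrite ?eqxx ?orbT // in ef *.
by case=> /orP[]/eqP ? /orP[]/eqP ?; subst; rewrite ?eqxx ?orbT // in cd *.
Qed.

Lemma strip_exchange w w' p q new s (C := local_interchange w p q new s) :
    exchange w w' -> paired new s -> run_ok true w [:: p; q] new s ->
  (~~ C -> strip_equiv new s w [:: p; q] w' [:: q; p]) /\
  (C -> strip_equiv new s w [:: p; q] w' [:: ~~ q; ~~ p]).
Proof.
rewrite /C {C}; case=> l h j k le_jk ps ok.
- have := fits_run ok; rewrite /= => /and3P[hj hk _].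
  have [] := @split_exchange s j k (fan_in l) (fan_in h) le_jk; first lia.
  move=> u [x [m [y [v [es su sx sm sy]]]]]; rewrite {s hj hk}es in ps ok *.
  have [okE _ _] := low_firstE new v su sx sm sy p q.
  have := ok; rewrite okE => /and4P[okx _ oky _].
  have CE : l = Crossing -> h = Crossing ->
     local_interchange [:: Event l j; Event h (k - fan_in l + fan_out l)] p q new
       (u ++ x ++ m ++ y ++ v) = (p (+) q) && all (mem x) y.
    move=> lX hX; rewrite /local_interchange (chunk_step _ su sx) /=.
    have sz : size (u ++ outgoing l p new x ++ m) = k - fan_in l + fan_out l.
      by rewrite -sm !size_cat sx (size_outgoing sx); lia.
    rewrite -sz.
    have -> : u ++ outgoing l p new x ++ m ++ y ++ v
            = (u ++ outgoing l p new x ++ m) ++ y ++ v by rewrite -!catA.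
    move: okx oky; rewrite lX hX; case: (x) => [|c [|d []]] // _.
    by case: (y) => [|e [|f []]] // _; rewrite -su !nth_take_drop_pair.
  split=> hC.
    have [] := exchange_plain su sx sm sy ps (a := p) (b := q).
      case/and3P=> lX hX pq; move: hC; rewrite CE ?pq //.
        by move: lX; rewrite /is_crossing /=; case: (l).
      by move: hX; rewrite /is_crossing /=; case: (h).
    move=> E W; split; [by rewrite -E | exact: exchange_similar | by rewrite W].
  have [lX hX] : l = Crossing /\ h = Crossing.
    by move: hC; rewrite /local_interchange /is_crossing /=; case: (l) (h) => [] [].
  move: hC; rewrite CE // => /andP[pq yx].
  have [E W S] := exchange_swap su sx sm sy ps lX hX pq yx okx oky.
  by split; [rewrite -E | exact: S | rewrite W].
have := fits_run ok; rewrite /= => /and3P[hk _ _].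
have [u [x [m [y [v [es su sx sm sy]]]]]] := split_exchange le_jk hk.
rewrite {s hk}es in ps ok *.
have [okE _ _] := high_firstE new v su sx sm sy q p.
have := ok; rewrite okE => /and4P[oky _ okx _].
have CE : l = Crossing -> h = Crossing ->
   local_interchange [:: Event h k; Event l j] p q new
     (u ++ x ++ m ++ y ++ v) = (p (+) q) && all (mem x) y.
  move=> lX hX; rewrite /local_interchange.
  have -> : u ++ x ++ m ++ y ++ v = (u ++ x ++ m) ++ y ++ v by rewrite -!catA.
  rewrite (chunk_step _ sm sy) -!catA /= -sm.
  move: okx oky; rewrite lX hX; case: (x) => [|c [|d []]] // cd.
  case: (y) => [|e [|f []]] // ef; rewrite all_mem_pair // -su !nth_take_drop_pair.
  have -> : u ++ [:: c; d] ++ m ++ [:: e; f] ++ v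
          = (u ++ [:: c; d] ++ m) ++ [:: e, f & v] by rewrite -!catA.
  by rewrite !nth_take_drop_pair.
split=> hC.
  have [] := exchange_plain su sx sm sy ps (a := q) (b := p).
    case/and3P=> lX hX pq; move: hC; rewrite CE 1?addbC ?pq //.
      by move: lX; rewrite /is_crossing /=; case: (l).
    by move: hX; rewrite /is_crossing /=; case: (h).
  move=> E W; split; [by rewrite E | by apply/similar_sym/exchange_similar |].
  by rewrite W // E.
have [lX hX] : l = Crossing /\ h = Crossing.
  by move: hC; rewrite /local_interchange /is_crossing /=; case: (l) (h) => [] [].
move: hC; rewrite CE // => /andP[pq yx].
have pq' : ~~ q (+) ~~ p by rewrite addbN addNb negbK addbC.
have okx' : incoming_ok l (~~ q) x by move: okx; rewrite lX.
have oky' : incoming_ok h (~~ p) y by move: oky; rewrite hX.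
have := exchange_swap su sx sm sy ps lX hX pq' yx okx' oky'; rewrite !negbK.
by case=> E W S; split; [rewrite E | exact: similar_sym S | rewrite W].
Qed.

Lemma size_exchange w w' : exchange w w' -> size w = 2 /\ size w' = 2.
Proof. by case. Qed.

Lemma move_balanced D D' (mv : move D D') rho rho' : corresponds mv rho rho' ->
  is_front D' -> balanced D rho -> balanced D' rho'.
Proof.
move=> corr; case: D D' mv rho rho' / corr => //.
- move=> A B w w' m a b p q sa hC fr hi; have [sw sw'] := size_exchange m.
  have ok := run_ok_weaken hi.1.
  apply: (local_move (t' := [:: q; p]) sa _ _ hi) => // okA ps okw _.
  have [E _] := strip_exchange m ps okw.
  by apply: E; rewrite -(interchanges_local sa sw ok).
- move=> A B w w' m a b p q sa hC fr hi; have [sw sw'] := size_exchange m.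
  have ok := run_ok_weaken hi.1.
  apply: (local_move (t' := [:: ~~ q; ~~ p]) sa _ _ hi) => // okA ps okw _.
  have [_ E] := strip_exchange m ps okw.
  by apply: E; rewrite -(interchanges_local sa sw ok).
- move=> A B w m a b sa fr hi.
  have sw : 3 = size w by case: (m).
  apply: (@local_move A [::] w B a [::] _ b) => // okA ps _ fit.
  have [ok' r W] := strip_R1 m ps fit.
  by split; rewrite ?ok' ?r ?W //; apply: similar_refl.
- move=> A B w m a b sa fr hi.
  have sw : 3 = size w by case: (m).
  apply: (@local_move A w [::] B a [:: false; true; false] [::] b) => //.
  move=> okA ps ok _.
  have [ok' r W] := strip_R1 m ps (fits_run ok).
  by split; rewrite ?r ?W //; apply: similar_refl.
- move=> A B w w' m a b sa fr hi.
  have [sw sw'] : 1 = size w /\ 3 = size w' by case: (m).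
  apply: (local_move _ _ _ hi) => // okA ps ok fit.
  have [E] := strip_R2 m ps fit; rewrite ok => /(_ isT) [r W W'].
  by split; rewrite ?E ?ok ?r ?W ?W' //; apply: similar_refl.
- move=> A B w w' m a b sa fr hi.
  have [sw sw'] : 1 = size w /\ 3 = size w' by case: (m).
  apply: (local_move _ _ _ hi) => // okA ps ok fit.
  have [E] := strip_R2 m ps (fits_run ok); rewrite -E ok => /(_ isT) [r W W'].
  by split; rewrite -?E ?ok ?r ?W ?W' //; apply: similar_refl.
- move=> A B w w' m a b t t' sa ht hpr fr hi.
  have [sw sw'] : 3 = size w /\ 3 = size w' by case: (m).
  have [st st'] : size t = 3 /\ size t' = 3 by case: ht.
  apply: (local_move _ _ _ hi); rewrite ?st ?st' // => okA ps ok fit.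
  apply: (strip_R3 m ht ps _ ok) => tE ok' sim.
  (* The image of the ruling is valid up to normality, which it has by
     assumption; and labels can express normality. *)
  have := hi.1; rewrite !run_ok_cat ?st // ?sw // => /and3P[_ _ okB].
  have okD' : run_ok false (A ++ w' ++ B) (a ++ t' ++ b) 0 [::].
    rewrite !run_ok_cat ?st' // (run_ok_weaken okA) add0n ok' /=.
    have ps' := paired_run ok' ps; have psw := paired_run ok ps.
    by have [] := run_similar psw ps' sim (run_ok_weaken okB).
  have := normal_ruling_run_ok okD' (hpr tE).
  by rewrite !run_ok_cat ?st' // => /and3P[].
- move=> A B k a b sa fr hi.
  apply: (@local_move A [::] [:: 'L_k; 'R_k] B a [::] [:: false; false] b) => //.
  move=> okA ps _ fit.
  have [ok' r W] := strip_handle0 (size A) fit.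
  by split; rewrite ?ok' ?r ?W //; apply: similar_refl.
move=> A B k a b sa fr hi.
apply: (@local_move A [:: 'R_k; 'L_k] [::] B a [:: false; false] [::] b) => //.
move=> okA ps ok _.
have [sim W] := strip_handle1 ps ok.
by split; rewrite ?W.
Qed.

Theorem theorem3 (D : diagram) (L : filling D) (rho : bitseq)
  (hrho : associated_ruling L rho) : ~~ odd (clasps D rho).
Proof.
have [fr [ok W]] : is_front D /\ balanced D rho.
  elim: hrho => {D L rho} [D m fr rho corr|D D' L m fr rho rho' _ [_ IH] corr].
    by split=> //; apply: move_balanced corr fr _.
  by split=> //; apply: move_balanced corr fr IH.
have := clasps_weight (run_ok_weaken ok) fr; rewrite W.
move=> E; have : clasps D rho %% 2 = 0 by lia.
by rewrite modn2; case: odd.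
Qed.
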